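(* Let $f$ and $f_n$ ($n\ge 1$) be proper convex lower semicontinuous functions from $\mathbb{R}^d$ to $\mathbb{R}\cup\{+\infty\}$. Assume that $\inf f\in\mathbb{R}$. Let $f_l$ and $f_u$ be the lower and upper epigraphical limits of $\{f_n\}_n$. Then the following assertions are equivalent: (i) $f_n\xrightarrow{e}f$. (ii) $s_{f_n}\xrightarrow{e}s_f$, and there exist $(x,x^* )\in\mathbb{R}^d\times\mathbb{R}^d$ with $x^*\in\partial f(x)$ and a sequence $\{(x_n,x_n^* )\}_n$ in $\mathbb{R}^d\times\mathbb{R}^d$ with $x_n^*\in\partial f_n(x_n)$ for all $n$ such that $(x_n,x_n^*,f_n(x_n))\to(x,x^*,f(x))$ as $n\to\infty$. (iii) $s_{f_n}\xrightarrow{e}s_f$ and $\inf f_l=\inf f=\inf f_u$.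
   Context: $\mathbb{R}^d$ carries its usual inner product $\langle\cdot,\cdot\rangle$ and Euclidean norm $\|\cdot\|$. For a proper convex lower semicontinuous function $f:\mathbb{R}^d\to\mathbb{R}\cup\{+\infty\}$, the subdifferential is $\partial f(x)=\{x^*\in\mathbb{R}^d: f(y)\ge f(x)+\langle x^*,y-x\rangle\ \forall y\in\mathbb{R}^d\}$ if $f(x)<+\infty$, and $\partial f(x)=\emptyset$ otherwise. The slope of $f$ is the function $s_f:\mathbb{R}^d\to[0,+\infty]$, $s_f(x)=\mathrm{dist}(0,\partial f(x))=\inf\{\|x^*\|:x^*\in\partial f(x)\}$, with $s_f(x)=+\infty$ if $\partial f(x)=\emptyset$. For a sequence $\{\phi_n\}_n$ of functions $\mathbb{R}^d\to\mathbb{R}\cup\{+\infty\}$, the lower and upper epigraphical limits are the functions $\phi_l,\phi_u:\mathbb{R}^d\to\mathbb{R}\cup\{\pm\infty\}$ given by $\phi_l(x)=\inf_{x_n\to x}\liminf_{n\to\infty}\phi_n(x_n)$ and $\phi_u(x)=\inf_{x_n\to x}\limsup_{n\to\infty}\phi_n(x_n)$, the infima being over all sequences $\{x_n\}_n\subset\mathbb{R}^d$ converging to $x$. $\phi_n\xrightarrow{e}\phi$ (epigraphical convergence) means that the epigraphs $\mathrm{epi}\,\phi_n=\{(x,\alpha)\in\mathbb{R}^d\times\mathbb{R}:\alpha\ge\phi_n(x)\}$ converge to $\mathrm{epi}\,\phi$ in the Painlevé–Kuratowski sense: $\{z:\liminf_n\mathrm{dist}(z,\mathrm{epi}\,\phi_n)=0\}=\mathrm{epi}\,\phi=\{z:\limsup_n\mathrm{dist}(z,\mathrm{epi}\,\phi_n)=0\}$.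 Equivalently, $\phi_l=\phi=\phi_u$. *)

(* Defs.v *)
From HB Require Import structures.
From mathcomp Require Import all_boot all_order all_algebra.
From mathcomp Require Import all_classical all_reals ereal topology normedtype sequences.

Set Implicit Arguments.
Unset Strict Implicit.
Unset Printing Implicit Defensive.

Import Order.TTheory GRing.Theory Num.Theory.
Import numFieldNormedType.Exports.

Local Open Scope classical_set_scope.
Local Open Scope ring_scope.

(* R^d is 'rV[R]_d.  The norm `|x| of the library on row vectors is the sup
   norm, hence the Euclidean norm below; both induce the same topology, and
   convergence and semicontinuity are taken in the library topology. *)
Definition dot (R : realType) (d : nat) (x y : 'rV[R]_d) : R :=
  \sum_(i < d) x 0 i * y 0 i.

Definition enorm (R : realType) (d : nat) (x : 'rV[R]_d) : R :=
  Num.sqrt (dot x x).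

Definition enorm_prod (R : realType) (d : nat) (z : 'rV[R]_d * R) : R :=
  Num.sqrt (enorm z.1 ^+ 2 + z.2 ^+ 2).

(* +oo when C is empty. *)
Definition dist_prod (R : realType) (d : nat)
    (z : 'rV[R]_d * R) (C : set ('rV[R]_d * R)) : \bar R :=
  ereal_inf [set (enorm_prod (z - w))%:E | w in C].

Definition proper_fun (R : realType) (d : nat) (f : 'rV[R]_d -> \bar R) : Prop :=
  (forall x, -oo < f x)%E /\ (exists x, f x < +oo)%E.

(* With values in ]-oo, +oo], the right-hand side has no undefined sum, and at
   t = 0 or t = 1 the library convention 0 * +oo = 0 makes it trivial. *)
Definition convex_fun (R : realType) (d : nat) (f : 'rV[R]_d -> \bar R) : Prop :=
  forall (x y : 'rV[R]_d) (t : R), 0 <= t -> t <= 1 ->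
    (f (t *: x + (1 - t) *: y)%R <= t%:E * f x + (1 - t)%:E * f y)%E.

Definition subdiff (R : realType) (d : nat) (f : 'rV[R]_d -> \bar R)
    (x : 'rV[R]_d) : set 'rV[R]_d :=
  [set p | (f x < +oo)%E /\ forall y, (f x + (dot p (y - x))%:E <= f y)%E].

(* +oo when the subdifferential is empty. *)
Definition slope (R : realType) (d : nat) (f : 'rV[R]_d -> \bar R)
    (x : 'rV[R]_d) : \bar R :=
  ereal_inf [set (enorm p)%:E | p in subdiff f x].

Definition epi_liminf (R : realType) (d : nat)
    (phi : nat -> 'rV[R]_d -> \bar R) (x : 'rV[R]_d) : \bar R :=
  ereal_inf [set limn_einf (fun n => phi n (u n)) |
    u in [set u : nat -> 'rV[R]_d | u @ \oo --> x]].

Definition epi_limsup (R : realType) (d : nat)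
    (phi : nat -> 'rV[R]_d -> \bar R) (x : 'rV[R]_d) : \bar R :=
  ereal_inf [set limn_esup (fun n => phi n (u n)) |
    u in [set u : nat -> 'rV[R]_d | u @ \oo --> x]].

Definition epi (R : realType) (d : nat) (phi : 'rV[R]_d -> \bar R) :
    set ('rV[R]_d * R) :=
  [set z | (phi z.1 <= z.2%:E)%E].

(* Painleve-Kuratowski convergence *)
Definition pk_cvg (R : realType) (d : nat)
    (C_ : nat -> set ('rV[R]_d * R)) (C : set ('rV[R]_d * R)) : Prop :=
  [set z | limn_einf (fun n => dist_prod z (C_ n)) = 0%E] = C /\
  C = [set z | limn_esup (fun n => dist_prod z (C_ n)) = 0%E].

Definition epi_cvg (R : realType) (d : nat)
    (phi_ : nat -> 'rV[R]_d -> \bar R) (phi : 'rV[R]_d -> \bar R) : Prop :=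
  pk_cvg (fun n => epi (phi_ n)) (epi phi).

(* Main.v *)
Require Import Defs.
From mathcomp Require Import all_boot all_order all_algebra.
From mathcomp Require Import all_classical all_reals ereal topology normedtype sequences.
From mathcomp Require Import ring lra.

Import Order.TTheory GRing.Theory Num.Theory.
Import numFieldNormedType.Exports.

Local Open Scope classical_set_scope.
Local Open Scope ring_scope.

(** Why the three assertions are equivalent.

    A convex function bounded below is determined by its slope and its infimum.
    Indeed let f and h have the same slope and follow the proximal descent
    x_(k+1) = x_k - l p_(k+1), with p_(k+1) a subgradient of f at x_(k+1).  Then
    f drops by at least the sum of the l |p_k|^2, whereas h drops by at most the
    sum of the (slope of h at x_k) |x_k - x_(k+1)|, that is l |p_k| |p_(k+1)|,
    which differs from the former sum by O(l).  As f is bounded below, the sum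
    of the |p_k|^2 is finite, so |p_k| |x_k - x_0| is small for suitable k, and
    both functions end up near their infimum.  Hence
    h x_0 - inf h <= f x_0 - inf f, and conversely.

    The argument is robust.  descent_comparison proves it for two functions
    whose slopes are merely close on a bounded set, with constants that do not
    depend on the functions.  So no subsequences are needed: convergence of
    epigraphs is first made uniform on bounded sets, in each direction
    separately (epi_excess_of_cvg, epi_cvg_of_excess), and the comparison is
    then applied both to (f, f_n) and to (f_n, f).

    (iii) implies (i) is epi_excess_of_graph_excess: the conditions on f_l and
    f_u say that the infima of the f_n converge to inf f on bounded sets
    (eventually_above, eventually_reaches).

    For (ii) implies (iii), the convergence of the infima comes from the same
    comparison, started at the points where f_n and f almost agree: descending
    along f bounds f_n from below, descending along f_n bounds it from above.
    Epigraphical convergence follows as before and yields the statement on f_l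
    and f_u.

    (i) implies (ii) is the classical direction of the Attouch theorem, made
    quantitative in subgrad_transfer: a subgradient of f is an approximate
    subgradient of f_n, and Brondsted-Rockafellar corrects it to an exact one.
    Exchanging the roles of f and f_n gives the other half of the convergence of
    slopes. *)

Set Implicit Arguments.
Unset Strict Implicit.

(** * Euclidean geometry of row vectors *)

Section Euclidean.
Context {R : realType} {d : nat}.
Implicit Types (x y z : 'rV[R]_d) (a b c : R).

Lemma dotC x y : dot x y = dot y x.
Proof. by apply: eq_bigr => i _; rewrite mulrC. Qed.

Lemma dotDl x y z : dot (x + y) z = dot x z + dot y z.
Proof. by rewrite -big_split; apply: eq_bigr => i _; rewrite mxE mulrDl. Qed.

Lemma dotZl a x y : dot (a *: x) y = a * dot x y.
Proof. by rewrite mulr_sumr; apply: eq_bigr => i _; rewrite mxE mulrA. Qed.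

Lemma dotNl x y : dot (- x) y = - dot x y.
Proof. by rewrite -scaleN1r dotZl mulN1r. Qed.

Lemma dotBl x y z : dot (x - y) z = dot x z - dot y z.
Proof. by rewrite dotDl dotNl. Qed.

Lemma dotDr x y z : dot x (y + z) = dot x y + dot x z.
Proof. by rewrite !(dotC x) dotDl. Qed.

Lemma dotNr x y : dot x (- y) = - dot x y.
Proof. by rewrite !(dotC x) dotNl. Qed.

Lemma dotBr x y z : dot x (y - z) = dot x y - dot x z.
Proof. by rewrite dotDr dotNr. Qed.

Lemma dotZr a x y : dot x (a *: y) = a * dot x y.
Proof. by rewrite !(dotC x) dotZl. Qed.

Lemma dot0l x : dot 0 x = 0.
Proof. by rewrite -(scale0r 0) dotZl mul0r. Qed.

Lemma dot0r x : dot x 0 = 0.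
Proof. by rewrite dotC dot0l. Qed.

Lemma dot_ge0 x : 0 <= dot x x.
Proof. by apply: sumr_ge0 => i _; rewrite -expr2 sqr_ge0. Qed.

Lemma enorm_ge0 x : 0 <= enorm x.
Proof. exact: sqrtr_ge0. Qed.

Lemma enorm_sqr x : enorm x ^+ 2 = dot x x.
Proof. by rewrite sqr_sqrtr// dot_ge0. Qed.

Lemma enorm_sqrD x y :
  enorm (x + y) ^+ 2 = enorm x ^+ 2 + 2 * dot x y + enorm y ^+ 2.
Proof. by rewrite !enorm_sqr dotDl !dotDr (dotC y x); ring. Qed.

Lemma enorm0 : enorm (0 : 'rV[R]_d) = 0.
Proof. by rewrite /enorm dot0l sqrtr0. Qed.

Lemma enormN x : enorm (- x) = enorm x.
Proof. by rewrite /enorm dotNl dotNr opprK. Qed.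

Lemma enormB x y : enorm (x - y) = enorm (y - x).
Proof. by rewrite -enormN opprB. Qed.

Lemma enormZ a x : enorm (a *: x) = `|a| * enorm x.
Proof.
by rewrite /enorm dotZl dotZr mulrA -expr2 sqrtrM ?sqr_ge0// sqrtr_sqr.
Qed.

(** The vector e = |y| x - |x| y satisfies
    0 <= |e|^2 = 2 |x| |y| (|x| |y| - <x, y>). *)
Lemma cauchy_schwarz x y : dot x y <= enorm x * enorm y.
Proof.
have [x0|x0] := eqVneq (enorm x) 0; last have [y0|y0] := eqVneq (enorm y) 0.
- rewrite x0 mul0r dotC; have : dot x x = 0 by rewrite -enorm_sqr x0 expr0n.
  move/eqP; rewrite psumr_eq0 => [|i _]; last by rewrite -expr2 sqr_ge0.
  move=> /allP xi0; rewrite /dot big1// => i _.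
  by have := xi0 i (mem_index_enum _); rewrite mulf_eq0 orbb => /eqP ->; rewrite mulr0.
- rewrite y0 mulr0; have : dot y y = 0 by rewrite -enorm_sqr y0 expr0n.
  move/eqP; rewrite psumr_eq0 => [|i _]; last by rewrite -expr2 sqr_ge0.
  move=> /allP yi0; rewrite /dot big1// => i _.
  by have := yi0 i (mem_index_enum _); rewrite mulf_eq0 orbb => /eqP ->; rewrite mulr0.
- have := dot_ge0 (enorm y *: x - enorm x *: y).
  rewrite dotBl !dotBr !dotZl !dotZr -!enorm_sqr (dotC y x).
  have nx : 0 < enorm x by rewrite lt_def x0 enorm_ge0.
  have ny : 0 < enorm y by rewrite lt_def y0 enorm_ge0.
  rewrite -subr_ge0 => h.
  have {h} : 0 <= (enorm x * enorm y) * (enorm x * enorm y - dot x y) by lra.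
  by rewrite pmulr_rge0 ?mulr_gt0// subr_ge0.
Qed.

Lemma cauchy_schwarzN x y : - (enorm x * enorm y) <= dot x y.
Proof. by rewrite lerNl -dotNl -(enormN x) cauchy_schwarz. Qed.

Lemma enormD x y : enorm (x + y) <= enorm x + enorm y.
Proof.
rewrite -(@ler_pXn2r _ 2)// ?nnegrE ?addr_ge0 ?enorm_ge0//.
rewrite sqrrD !enorm_sqr dotDl !dotDr (dotC y x).
have := cauchy_schwarz x y; lra.
Qed.

Lemma enorm_dist x y z : enorm (x - z) <= enorm (x - y) + enorm (y - z).
Proof. by rewrite -{1}(subrKA y) enormD. Qed.

Lemma enorm_le_dist x y : enorm x <= enorm y + enorm (x - y).
Proof. by rewrite -{1}(subrK y x) addrC enormD. Qed.

Lemma normr_le_enorm x : `|x| <= enorm x.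
Proof.
rewrite [leLHS]/Num.norm /= mx_normrE; apply/bigmax_leP; split=> [|[i j] _ /=].
  exact: enorm_ge0.
rewrite (ord1 i) -(@ler_pXn2r _ 2)// ?nnegrE ?enorm_ge0// enorm_sqr real_normK ?num_real//.
rewrite /dot (bigD1 j)//= -expr2 lerDl.
by apply: sumr_ge0 => k _; rewrite -expr2 sqr_ge0.
Qed.

Lemma enorm_le_normr x : enorm x <= d.+1%:R * `|x|.
Proof.
rewrite -(@ler_pXn2r _ 2)// ?nnegrE ?enorm_ge0 ?mulr_ge0// enorm_sqr.
apply: (@le_trans _ _ (\sum_(i < d) `|x| ^+ 2)).
  apply: ler_sum => i _; rewrite -expr2 -real_normK ?num_real//.
  rewrite ler_pXn2r ?nnegrE// [leRHS]/Num.norm /= mx_normrE.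
  by apply/bigmax_geP; right => /=; exists (0, i).
rewrite sumr_const card_ord -[leLHS]mulr_natl [leRHS]exprMn; apply: ler_wpM2r; first exact: sqr_ge0.
by rewrite -natrX ler_nat (leq_trans (leqnSn _))// leq_pmulr.
Qed.

(** The topology on row vectors comes from the sup norm, and
    |x|_sup <= |x| <= (d + 1) |x|_sup. *)
Lemma nbhs_enormP x (V : set 'rV[R]_d) :
  nbhs x V <-> exists2 e, 0 < e & forall y, enorm (y - x) < e -> V y.
Proof.
split=> [/nbhs_ballP[e e0 xV]|[e e0 xV]].
  exists e => // y yx; apply: xV; rewrite -ball_normE /ball_/= distrC.
  exact: le_lt_trans (normr_le_enorm _) yx.
apply/nbhs_ballP; exists (e / d.+1%:R); first by rewrite /= divr_gt0.
move=> y; rewrite -ball_normE /ball_/= distrC => yx; apply: xV.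
by apply: le_lt_trans (enorm_le_normr _) _; rewrite mulrC -ltr_pdivlMr.
Qed.

Lemma cvg_enormP (u : nat -> 'rV[R]_d) x :
  u @ \oo --> x <-> forall e, 0 < e -> \forall n \near \oo, enorm (u n - x) < e.
Proof.
split=> [ux e e0|ux V /nbhs_enormP[e e0 xV]].
  by apply: (ux [set y | enorm (y - x) < e]); apply/nbhs_enormP; exists e.
by apply: filterS (ux e e0) => n /=; exact: xV.
Qed.

Lemma enorm_ball_compact x r : compact [set y | enorm (y - x) <= r].
Proof.
apply: bounded_closed_compact.
  exists (enorm x + r); split; first exact: num_real.
  move=> M rM y /= yx; apply: le_trans (normr_le_enorm _) _.
  by have := enorm_le_dist y x; lra.
rewrite -openC openE => y /= /negP; rewrite -ltNge => ryx; apply/nbhs_enormP.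
exists (enorm (y - x) - r); first by rewrite subr_gt0.
move=> z zy /= zx; have := enorm_dist y z x; rewrite (enormB y z); lra.
Qed.

End Euclidean.

(** * Subgradients and the Brondsted-Rockafellar lemma *)

Lemma ereal_lt_real (R : realType) (x y : \bar R) : (x < y)%E ->
  exists a : R, (x < a%:E)%E && (a%:E < y)%E.
Proof.
case: x y => [x| |] [y| |]//= xy.
- by exists ((x + y) / 2); move: xy; rewrite !lte_fin; lra.
- by exists (x + 1); rewrite lte_fin ltry; lra.
- by exists (y - 1); rewrite lte_fin ltNyr; lra.
- by exists 0; rewrite ltNyr ltry.
Qed.

(** The sublevel sets of G in K are totally ordered by inclusion, hence form a
    filter base; lower semicontinuity makes any cluster point of it a
    minimizer. *)
Lemma lsc_attains_min (R : realType) (T : topologicalType) (G : T -> \bar R)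
    (K : set T) :
  compact K -> K !=set0 -> lower_semicontinuous G ->
  exists2 w, K w & forall y, K y -> (G w <= G y)%E.
Proof.
move=> cK [x0 Kx0] lscG.
pose F := filter_from K (fun x => [set y | K y /\ (G y <= G x)%E]).
have FF : ProperFilter F.
  apply: filter_from_proper => [|x Kx]; last by exists x.
  apply: filter_from_filter; first by exists x0.
  move=> x y Kx Ky; have [xy|yx] := leP (G x) (G y).
    by exists x => // z [Kz zx]; split; split => //; exact: le_trans xy.
  by exists y => // z [Kz zy]; split; split => //; exact: le_trans (ltW yx).
have [|w [Kw clw]] := cK F FF; first by exists x0 => // y [].
exists w => // x Kx; rewrite leNgt; apply/negP => /ereal_lt_real[a /andP[xa aw]].
have [V wV aV] := lscG _ _ aw.
have [y [[_ yx] /aV ay]] := clw [set y | K y /\ (G y <= G x)%E] V (ex_intro2 _ _ x Kx (fun _ h => h)) wV.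
by have := lt_le_trans (lt_trans xa ay) yx; rewrite ltxx.
Qed.

Lemma le_of_vanishing (R : realFieldType) (A B C t0 : R) : 0 < t0 -> 0 <= C ->
  (forall t, 0 < t -> t <= t0 -> A <= B + t * C) -> A <= B.
Proof.
move=> t00 C0 h; rewrite leNgt; apply/negP => BA.
pose u := (A - B) / (2 * (C + 1)).
have C1 : 0 < 2 * (C + 1) by lra.
have u0 : 0 < u by rewrite divr_gt0// subr_gt0.
have uE : u * (2 * (C + 1)) = A - B by rewrite divfK// gt_eqF.
have := h (Num.min u t0); rewrite lt_min u0 t00 ge_min lexx orbT => /(_ isT isT).
have mu : Num.min u t0 <= u by rewrite ge_min lexx.
have := ler_wpM2r C0 mu; nra.
Qed.

Section Subgradients.
Context {R : realType} {d : nat}.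
Implicit Types (f g h : 'rV[R]_d -> \bar R) (x y z p : 'rV[R]_d) (a b c r : R).

Definition closed_convex f :=
  [/\ proper_fun f, convex_fun f & lower_semicontinuous f].

(** Recording the value a = f x turns the subgradient inequality, and every
    estimate derived from it, into inequalities between real numbers. *)
Definition subgrad f x p a :=
  f x = a%:E /\ forall y b, (f y <= b%:E)%E -> a + dot p (y - x) <= b.

Lemma subgrad_finite f x p a : subgrad f x p a -> (f x <= a%:E)%E.
Proof. by case=> ->. Qed.

Lemma subdiffP f x p : (forall y, -oo < f y)%E ->
  subdiff f x p <-> exists a, subgrad f x p a.
Proof.
move=> fNy; split=> [[fx fp]|[a [fxa fp]]].
  exists (fine (f x)); have fxE : f x = (fine (f x))%:E.
    by rewrite fineK// fin_real// fNy.
  split=> // y b fyb; have := le_trans (fp y) fyb.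
  by rewrite fxE -EFinD lee_fin.
split=> [|y]; first by rewrite fxa ltry.
rewrite fxa -EFinD; case E : (f y) => [b| |]; last 2 first.
- by rewrite leey.
- by have := fNy y; rewrite E.
by rewrite lee_fin; apply: fp; rewrite E.
Qed.

Lemma closed_convex_subdiffP f x p : closed_convex f ->
  subdiff f x p <-> exists a, subgrad f x p a.
Proof. by case=> -[fNy _] _ _; exact: subdiffP. Qed.

Lemma convex_real f x y a b t : convex_fun f -> 0 <= t -> t <= 1 ->
  (f x <= a%:E)%E -> (f y <= b%:E)%E ->
  (f (t *: x + (1 - t) *: y)%R <= (t * a + (1 - t) * b)%:E)%E.
Proof.
move=> cf t0 t1 fa fb; apply: le_trans (cf x y t t0 t1) _.
rewrite [leRHS]EFinD !EFinM; apply: leeD; apply: lee_wpmul2l => //.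
by rewrite lee_fin subr_ge0.
Qed.

Lemma closed_convex_fin f x a : closed_convex f -> (f x <= a%:E)%E ->
  exists2 b, f x = b%:E & b <= a.
Proof.
move=> [[fNy _] _ _] fxa; exists (fine (f x)).
  by rewrite fineK// fin_real// fNy (le_lt_trans fxa)// ltry.
by rewrite -lee_fin fineK// fin_real// fNy (le_lt_trans fxa)// ltry.
Qed.

(** Completing the square: up to a constant, the quadratic penalty centred at y
    with a linear tilt p is a quadratic penalty centred at y + l p. *)
Lemma enorm_sqr_expand x y p (l : R) : 0 < l ->
  enorm (x - (y + l *: p)) ^+ 2 / (2 * l) =
  enorm (x - y) ^+ 2 / (2 * l) - dot p (x - y) + l / 2 * enorm p ^+ 2.
Proof.
move=> l0; rewrite opprD addrA !enorm_sqr !(dotBl (x - y)) !(dotBr _ (x - y)).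
rewrite !dotZl !dotZr (dotC (x - y) p); field; lra.
Qed.

Lemma lsc_add_sqr_dist f z (k : R) : 0 < k -> lower_semicontinuous f ->
  lower_semicontinuous (fun y => f y + (enorm (y - z) ^+ 2 / k)%:E)%E.
Proof.
move=> k0 lf x a; rewrite -lteBlDr// -EFinB => /ereal_lt_real[b /andP[ab bx]].
have [V xV bV] := lf _ _ bx.
set c := fun y => enorm (y - z) ^+ 2 / k.
rewrite lte_fin -/(c x) in ab.
have Nx0 := enorm_ge0 (x - z).
pose e := (c x - (a - b)) * k / (2 * (enorm (x - z) + 1)).
have N1 : 0 < 2 * (enorm (x - z) + 1) by lra.
have e0 : 0 < e by rewrite !(divr_gt0, mulr_gt0)//; lra.
have eE : e * (2 * (enorm (x - z) + 1)) = (c x - (a - b)) * k.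
  by rewrite divfK// gt_eqF.
have near_c : nbhs x [set y | a - b < c y].
  apply/nbhs_enormP; exists e => //= y yx.
  rewrite -(ltr_pM2r k0) divfK ?gt_eqF//.
  have cxk : c x * k = enorm (x - z) ^+ 2 by rewrite divfK// gt_eqF.
  have XY : enorm (x - z) - enorm (y - z) < e.
    by have := enorm_dist x y z; rewrite (enormB x y); lra.
  have Ny0 := enorm_ge0 (y - z).
  have : enorm (x - z) ^+ 2 - enorm (y - z) ^+ 2 < e * (2 * (enorm (x - z) + 1)).
    rewrite subr_sqr; have [yx'|xy] := leP (enorm (x - z)) (enorm (y - z)).
      apply: (@le_lt_trans _ _ 0); last exact: mulr_gt0.
      by rewrite mulr_le0_ge0 ?subr_le0 ?addr_ge0.
    by apply: ltr_pM => //; lra.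
  by lra.
exists (V `&` [set y | a - b < c y]); first exact: filterI.
move=> y [/bV fb /= cb]; rewrite -lteBlDr// -EFinB; apply: le_lt_trans fb.
by rewrite lee_fin -/(c y); lra.
Qed.

(** Brondsted-Rockafellar: if p is a c-subgradient of h at y0, then h has an
    exact subgradient close to p at a point close to y0.  Only the values of h
    on a ball around y0 matter.  The function
    h - <p, . - y0> + |. - y0|^2 / (2 l) attains its minimum over the compact
    ball; because c < r^2 / (2 l) the minimizer w is interior, and comparing w
    with w + t (y - w) as t tends to 0 gives, by convexity, the subgradient
    inequality at w against every y.  The case p = 0 is the proximal map of
    h. *)
Theorem brondsted_rockafellar h p y0 a c r (l : R) :
  closed_convex h -> 0 < l -> 0 < r -> c < r ^+ 2 / (2 * l) -> h y0 = a%:E ->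
  (forall y b, enorm (y - y0) <= r -> (h y <= b%:E)%E ->
     a - c <= b - dot p (y - y0)) ->
  exists w b, [/\ subgrad h w (p + l^-1 *: (y0 - w)) b, enorm (w - y0) < r &
    b - dot p (w - y0) + enorm (w - y0) ^+ 2 / (2 * l) <= a].
Proof.
move=> ch l0 r0 cr hy0 hc; have [[hNy _] cvh lsch] := ch.
have l20 : 0 < 2 * l by lra.
set z := y0 + l *: p.
have [|||w /= wr wmin] := @lsc_attains_min _ _
    (fun y => h y + (enorm (y - z) ^+ 2 / (2 * l))%:E)%E [set y | enorm (y - y0) <= r].
- exact: enorm_ball_compact.
- by exists y0; rewrite /= subrr enorm0 ltW.
- exact: lsc_add_sqr_dist.
have {}wmin y b : enorm (y - y0) <= r -> (h y <= b%:E)%E ->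
    (h w + (enorm (w - z) ^+ 2 / (2 * l))%:E <= (b + enorm (y - z) ^+ 2 / (2 * l))%:E)%E.
  by move=> yr hyb; rewrite (le_trans (wmin y yr))// EFinD leeD2r.
have [b hwb] : exists b, h w = b%:E.
  exists (fine (h w)); rewrite fineK// fin_real// hNy /=.
  have := wmin y0 a; rewrite subrr enorm0 hy0 => /(_ (ltW r0) (lexx _)).
  by case: (h w) => [v _|//|_]; rewrite ?ltry ?ltNyy.
rewrite hwb in wmin.
have {}wmin y v : enorm (y - y0) <= r -> (h y <= v%:E)%E ->
    b + enorm (w - z) ^+ 2 / (2 * l) <= v + enorm (y - z) ^+ 2 / (2 * l).
  by move=> yr hyv; have := wmin y v yr hyv; rewrite -EFinD lee_fin.
have key : b - dot p (w - y0) + enorm (w - y0) ^+ 2 / (2 * l) <= a.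
  have := wmin y0 a; rewrite subrr enorm0 hy0 => /(_ (ltW r0) (lexx _)).
  have -> := enorm_sqr_expand w y0 p l0; have -> := enorm_sqr_expand y0 y0 p l0.
  by rewrite subrr enorm0 dot0r expr0n mul0r subr0 add0r addrA lerD2r addrA addrAC.
have wr' : enorm (w - y0) < r.
  rewrite -(@ltr_pXn2r _ 2)// ?nnegrE ?enorm_ge0 ?(ltW r0)//.
  rewrite -(ltr_pM2r (x := (2 * l)^-1)) ?invr_gt0//.
  have := hc w b wr; rewrite hwb => /(_ (lexx _)); lra.
exists w, b; split=> //; split=> // y v hyv.
pose t0 := Num.min 1 ((r - enorm (w - y0)) / (enorm (y - w) + 1)).
have yw1 : 0 < enorm (y - w) + 1 by have := enorm_ge0 (y - w); lra.
apply: (@le_of_vanishing _ _ _ (enorm (y - w) ^+ 2 / (2 * l)) t0).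
- by rewrite lt_min ltr01 divr_gt0// subr_gt0.
- by rewrite divr_ge0 ?sqr_ge0// ltW.
move=> t t_gt0; rewrite le_min => /andP[t1 ttr].
have tr : t * enorm (y - w) <= r - enorm (w - y0).
  have : t * (enorm (y - w) + 1) <= r - enorm (w - y0) by rewrite -ler_pdivlMr.
  lra.
have ht : (h (t *: y + (1 - t) *: w)%R <= (t * v + (1 - t) * b)%:E)%E.
  by apply: convex_real => //; [exact: ltW|rewrite hwb].
have wtE : t *: y + (1 - t) *: w = w + t *: (y - w).
  by rewrite scalerBl scale1r scalerBr addrCA addrA.
rewrite wtE in ht; have := wmin _ _ _ ht.
have wt_r : enorm (w + t *: (y - w) - y0) <= r.
  rewrite (_ : _ - y0 = (w - y0) + t *: (y - w)); last exact: addrAC.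
  apply: le_trans (enormD _ _) _.
  by rewrite enormZ gtr0_norm//; lra.
move=> /(_ wt_r); rewrite (_ : w + t *: (y - w) - z = (w - z) + t *: (y - w)); last exact: addrAC.
rewrite (enorm_sqrD (w - z)) enormZ gtr0_norm// dotZr.
have -> : dot (w - z) (y - w) = dot (w - y0) (y - w) - l * dot p (y - w).
  by rewrite /z opprD addrA (dotBl (w - y0)) dotZl.
rewrite (dotDl p) dotZl -(opprB w y0) dotNl.
move: (enorm (w - z)) (dot (w - y0) _) (dot p (y - w)) (enorm (y - w)) => S A P D.
move=> H; rewrite -(ler_pM2l t_gt0) -subr_ge0.
suff -> : t * (v + t * (D ^+ 2 / (2 * l))) - t * (b + (P + l^-1 * - A)) =
   t * v + (1 - t) * b + (S ^+ 2 + 2 * (t * (A - l * P)) + (t * D) ^+ 2) / (2 * l)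
     - (b + S ^+ 2 / (2 * l)) by rewrite subr_ge0.
by field; lra.
Qed.

End Subgradients.

(** * Sequences with summable squares *)

Section SummableSquares.
Context {R : realType}.
Implicit Types (a : nat -> R) (B D K l e : R).

Lemma harmonic_sum_unbounded B : exists N, B < \sum_(k < N) k.+1%:R^-1.
Proof.
have ndh : nondecreasing_seq (series (@harmonic R)).
  by apply/nondecreasing_seqP => n; rewrite seriesSr lerDl invr_ge0.
have /cvgryPgt/(_ B)[N _ /(_ N (leqnn N))] :=
  nondecreasing_dvgn_lt ndh (@dvg_harmonic R).
by rewrite seriesEord => BN; exists N.
Qed.

Lemma sqr_sum_le a n : (forall k, 0 <= a k) ->
  (\sum_(k < n) a k) ^+ 2 <= n%:R * \sum_(k < n) a k ^+ 2.
Proof.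
move=> a0; elim: n => [|n IH]; first by rewrite !big_ord0 mulr0 expr0n.
rewrite !big_ord_recr/=.
set S := \sum_(_ < _) _ in IH *; set Q := \sum_(_ < _) _ in IH *.
have S0 : 0 <= S by apply: sumr_ge0.
have Q0 : 0 <= Q by apply: sumr_ge0 => k _; exact: sqr_ge0.
have an := a0 n.
have [n0|n0] := posnP n.
  have -> : S = 0 by rewrite /S; move: (n) n0 => m m0; subst m; rewrite big_ord0.
  by rewrite n0 add0r mul1r lerDr.
have nR : (1 : R) <= n%:R by rewrite ler1n.
(* 2 S a_n <= S^2 / n + n a_n^2, multiplied by n *)
have : 0 <= (S - n%:R * a n) ^+ 2 by exact: sqr_ge0.
rewrite -natr1; move: (n%:R : R) nR IH (a n) an => m m1 IH t t0 h.
have m0 : 0 < m by lra.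
rewrite -(ler_pM2l m0); nra.
Qed.

(** If all the products exceeded e, then, the partial sums up to k being at
    most of order sqrt k by Cauchy-Schwarz, a k ^ 2 would be at least of order
    1 / k and the sum of squares would diverge with the harmonic series.  The
    point is that N depends on K, l, D and e only. *)
Lemma small_scaled_term K l D e : 0 < K -> 0 < l -> 0 <= D -> 0 < e ->
  exists N, forall a, (forall k, 0 <= a k) ->
    (forall n, (n <= N)%N -> l * \sum_(k < n) a k ^+ 2 <= D) ->
    exists2 k, (k < N)%N & a k * (K + l * \sum_(j < k.+1) a j) <= e.
Proof.
move=> K0 l0 D0 e0; pose C := 2 * K ^+ 2 + 2 * (l * D).
have K20 : 0 < K ^+ 2 by rewrite exprn_gt0.
have lD0 : 0 <= l * D by rewrite mulr_ge0// ltW.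
have C0 : 0 < C by rewrite /C; lra.
have c0 : 0 < l * (e ^+ 2 / C) by rewrite mulr_gt0// divr_gt0// exprn_gt0.
have [N DN] := harmonic_sum_unbounded (D / (l * (e ^+ 2 / C))).
exists N => a a0 aD; apply: contrapT => no_small.
have {}no_small k : (k < N)%N -> e < a k * (K + l * \sum_(j < k.+1) a j).
  by move=> kN; rewrite ltNge; apply/negP => small; apply: no_small; exists k.
have big_sqr k : (k < N)%N -> e ^+ 2 / C * k.+1%:R^-1 <= a k ^+ 2.
  move=> kN; rewrite -mulrA -invfM ler_pdivrMr ?mulr_gt0//.
  have := no_small k kN.
  have := sqr_sum_le k.+1 a0.
  have := aD k.+1 kN.
  set S := \sum_(_ < _) a _; set Q := \sum_(_ < _) _ => QD SQ eaT.
  have S0 : 0 <= S by apply: sumr_ge0.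
  have k1 : (1 : R) <= k.+1%:R by rewrite ler1n.
  have ak := a0 k.
  have T2 : (K + l * S) ^+ 2 <= C * k.+1%:R.
    have lS : l * S ^+ 2 <= k.+1%:R * D.
      apply: le_trans (_ : l * (k.+1%:R * Q) <= _); first by rewrite ler_pM2l.
      by rewrite mulrCA ler_wpM2l//; lra.
    have : 0 <= (K - l * S) ^+ 2 by exact: sqr_ge0.
    have llS : l * (l * S ^+ 2) <= l * (k.+1%:R * D) by rewrite ler_pM2l.
    have KK : K ^+ 2 <= K ^+ 2 * k.+1%:R by rewrite ler_peMr// ltW.
    by rewrite /C; lra.
  apply: (@le_trans _ _ ((a k * (K + l * S)) ^+ 2)).
    by rewrite ler_pXn2r ?nnegrE// ltW//; exact: lt_trans eaT.
  by rewrite exprMn ler_wpM2l ?sqr_ge0.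
have := aD N (leqnn N); apply/negP; rewrite -ltNge.
move: DN; rewrite ltr_pdivrMr// mulrC => /lt_le_trans; apply.
rewrite -mulrA ler_pM2l// mulr_sumr; apply: ler_sum => k _; exact: big_sqr.
Qed.

End SummableSquares.

(** * Proximal descent and the comparison principle *)

Section Descent.
Context {R : realType} {d : nat}.
Implicit Types (f g h : 'rV[R]_d -> \bar R) (x y p : 'rV[R]_d) (a b c l : R).

Lemma subgrad_le g x p a y q b : subgrad g x p a -> subgrad g y q b ->
  a + dot p (y - x) <= b.
Proof. by move=> [_ gp] gq; apply: gp; exact: subgrad_finite gq. Qed.

Lemma subgrad_le_norm g x p a y b : subgrad g x p a -> (g y <= b%:E)%E ->
  a <= b + enorm p * enorm (y - x).
Proof. by move=> [_ gp] /gp; have := cauchy_schwarzN p (y - x); lra. Qed.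

(** One implicit descent step x - l q with q a subgradient at the arrival point.
    Monotonicity of the subdifferential makes the norm of the subgradient
    decrease. *)
Lemma prox_step g x p a l : closed_convex g -> subgrad g x p a -> 0 < l ->
  exists q b, [/\ subgrad g (x - l *: q) q b, enorm q <= enorm p &
    b + l * enorm q ^+ 2 <= a].
Proof.
move=> cg gp l0; have p0 := enorm_ge0 p; have [gxa gpx] := gp.
pose r := 2 * l * enorm p + 1.
have lp0 : 0 <= l * enorm p by rewrite mulr_ge0// ltW.
have r0 : 0 < r by rewrite /r; lra.
have cr : enorm p * r < r ^+ 2 / (2 * l).
  by rewrite ltr_pdivlMr; [rewrite /r; nra|lra].
have [|w [b [gq _ _]]] := @brondsted_rockafellar R d g 0 x a _ r l cg l0 r0 cr gxa.
  move=> y b yr gyb; rewrite dot0l subr0.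
  have := subgrad_le_norm gp gyb.
  by have := ler_wpM2l p0 yr; lra.
rewrite add0r in gq; set q := l^-1 *: (x - w) in gq.
have wE : w = x - l *: q by rewrite /q scalerA divff ?gt_eqF// scale1r subKr.
rewrite wE in gq; exists q, b.
have le1 := subgrad_le gq gp; have le2 := subgrad_le gp gq.
rewrite subKr dotZr -enorm_sqr in le1.
rewrite (addrAC x) subrr add0r dotNr dotZr in le2.
split=> //.
have q0 := enorm_ge0 q; have [->//|qn0] := eqVneq (enorm q) 0.
have {qn0} qpos : 0 < enorm q by rewrite lt_def qn0.
rewrite -(ler_pM2r qpos) -expr2 -(ler_pM2l l0).
have := cauchy_schwarz p q; move/(ler_wpM2l (ltW l0)); lra.
Qed.

Lemma prox_trajectory g x p a l : closed_convex g -> subgrad g x p a -> 0 < l ->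
  exists (X P : nat -> 'rV[R]_d) (A : nat -> R),
    [/\ X 0 = x, P 0 = p, A 0 = a &
      forall k, [/\ subgrad g (X k) (P k) (A k), X k.+1 = X k - l *: P k.+1,
        enorm (P k.+1) <= enorm (P k) &
        A k.+1 + l * enorm (P k.+1) ^+ 2 <= A k]].
Proof.
move=> cg gp l0.
pose T := {s : 'rV[R]_d * 'rV[R]_d * R | subgrad g s.1.1 s.1.2 s.2}.
pose step (s t : T) := [/\ (sval t).1.1 = (sval s).1.1 - l *: (sval t).1.2,
  enorm (sval t).1.2 <= enorm (sval s).1.2 &
  (sval t).2 + l * enorm (sval t).1.2 ^+ 2 <= (sval s).2].
have stepP (s : T) : {t : T | step s t}.
  apply: cid; have [q [b [gq qp bq]]] := prox_step cg (svalP s) l0.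
  by exists (exist _ ((sval s).1.1 - l *: q, q, b) gq).
have [u [u0 uS]] := dependent_choice stepP (exist _ (x, p, a) gp).
exists (fun k => (sval (u k)).1.1), (fun k => (sval (u k)).1.2), (fun k => (sval (u k)).2).
rewrite u0; split=> // k; have [? ? ?] := uS k; split=> //; exact: (svalP (u k)).
Qed.

Lemma shadow_step_bound (s t l e M : R) : 0 <= s -> 0 <= t -> 0 < l -> 0 < e ->
  e <= 1 -> s <= M -> t <= M ->
  (s + e) * (l * t + 2 * e) <=
    l / 2 * (s ^+ 2 + t ^+ 2) + e * (l * M + 2 * M + 2).
Proof.
move=> s0 t0 l0 e0 e1 sM tM.
have st : 0 <= l * (s - t) ^+ 2 by rewrite mulr_ge0 ?sqr_ge0// ltW.
have et : e * (l * t) <= e * (l * M) by rewrite ler_pM2l// ler_pM2l.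
have es : e * s <= e * M by rewrite ler_pM2l.
have ee : e * e <= e * 1 by rewrite ler_pM2l.
lra.
Qed.

(** The comparison principle on which the whole equivalence rests.  Follow the
    proximal descent of g from x0 with a small step l.  Each step decreases g by
    at least l |p_(k+1)|^2.  If every subgradient of g met on the way has a
    shadow, that is a subgradient of h of almost the same norm at almost the
    same point, then h decreases along the shadows by at most about
    l |p_k| |p_(k+1)| <= l (|p_k|^2 + |p_(k+1)|^2) / 2.  Summing up, the loss of
    h exceeds the loss of g by at most l |p_0|^2 / 2 plus a multiple of del.
    Since the total loss D of g bounds the sum of the l |p_k|^2, some step k
    bounded in advance has |p_k| (K + |x_k - x0|) small; at the shadow of x_k,
    h is then almost at its infimum over the ball of radius K.  The radius rad
    and the tolerance del do not depend on g, h and x0. *)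
Theorem descent_comparison (M K D eta : R) : 0 < M -> 0 <= K -> 0 <= D -> 0 < eta ->
  exists rad del, [/\ 0 <= rad, 0 < del & forall g h x0 p0 a0 x0' p0' a0',
    closed_convex g -> subgrad g x0 p0 a0 -> enorm p0 <= M ->
    (forall x b, enorm (x - x0) <= rad -> (g x <= b%:E)%E -> a0 - D <= b) ->
    (forall x p a, subgrad g x p a -> enorm (x - x0) <= rad -> enorm p <= M ->
      exists x' p' a', [/\ subgrad h x' p' a', enorm (x' - x) <= del &
        enorm p' <= enorm p + del]) ->
    subgrad h x0' p0' a0' -> enorm (x0' - x0) <= del ->
    enorm p0' <= enorm p0 + del ->
    exists x a, [/\ g x = a%:E, enorm (x - x0) <= rad &
      forall y c, enorm (y - x0) <= K -> (h y <= c%:E)%E ->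
        a0' + a <= a0 + c + eta]].
Proof.
move=> M0 K0 D0 eta0; have M20 : 0 < M ^+ 2 by rewrite exprn_gt0.
have [l l0 lM] : exists2 l : R, 0 < l & l * M ^+ 2 = eta.
  by exists (eta / M ^+ 2); [rewrite divr_gt0|rewrite divfK// gt_eqF].
have K1 : 0 < K + 1 by rewrite ltr_wpDl.
have eta4 : 0 < eta / 4 by rewrite divr_gt0.
have [N small] := small_scaled_term K1 l0 D0 eta4.
pose rad : R := l * M * N%:R; pose C : R := l * M + 2 * M + 2.
have lM0 : 0 < l * M by rewrite mulr_gt0.
have rad0 : 0 <= rad by rewrite mulr_ge0// ltW.
have C0 : 0 < C by rewrite /C; lra.
pose E : R := N%:R * C + K + 1 + rad.
have NC0 : 0 <= N%:R * C by rewrite mulr_ge0// ltW.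
have E0 : 0 < E by rewrite /E; lra.
(* With l M^2 = eta the step contributes eta / 2; the choice of k and the
   accumulated shadow errors contribute eta / 4 each. *)
have [del [del0 del1 delE]] : exists del : R, [/\ 0 < del, del <= 1 & del * E <= eta / 4].
  exists (Num.min 1 (eta / (4 * E))); split.
  - by rewrite lt_min ltr01 divr_gt0// mulr_gt0.
  - by rewrite ge_min lexx.
  - apply: (@le_trans _ _ (eta / (4 * E) * E)).
      by rewrite ler_pM2r// ge_min lexx orbT.
    by rewrite invfM mulrA divfK// gt_eqF.
exists rad, del; split=> // g h x0 p0 a0 x0' p0' a0' cg gp0 p0M glb shadow hp0 x0x p0p.
have [X [P [A [X0 P0 A0 XP]]]] := prox_trajectory cg gp0 l0.
pose S k := \sum_(j < k) enorm (P j.+1).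
pose Q k := \sum_(j < k) enorm (P j.+1) ^+ 2.
have PM k : enorm (P k) <= M.
  by elim: k => [|k IH]; [rewrite P0|have [_ _ /le_trans->] := XP k].
have Sdist k : enorm (X k - x0) <= l * S k.
  elim: k => [|k IH]; first by rewrite X0 subrr enorm0 /S big_ord0 mulr0.
  have [_ -> _ _] := XP k.
  rewrite addrAC (le_trans (enormD _ _))// enormN enormZ gtr0_norm//.
  by rewrite /S big_ord_recr/= mulrDr lerD2r.
have Srad k : (k <= N)%N -> l * S k <= rad.
  move=> kN; rewrite /rad -mulrA ler_pM2l//.
  apply: (@le_trans _ _ (\sum_(j < k) M)); first exact: ler_sum.
  by rewrite sumr_const card_ord -[leLHS]mulr_natr ler_pM2l// ler_nat.
have inball k : (k <= N)%N -> enorm (X k - x0) <= rad.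
  by move=> /Srad; exact: le_trans.
have energy k : A k + l * Q k <= a0.
  elim: k => [|k IH]; first by rewrite A0 /Q big_ord0 mulr0 addr0.
  by rewrite /Q big_ord_recr/= mulrDr -/(Q k); have [_ _ _] := XP k; lra.
have QD k : (k <= N)%N -> l * Q k <= D.
  move=> kN; have [gk _ _ _] := XP k.
  have := glb _ _ (inball k kN) (subgrad_finite gk); have := energy k; lra.
have comparison k : (k <= N)%N -> exists x' p' a',
    [/\ subgrad h x' p' a', enorm (x' - X k) <= del, enorm p' <= enorm (P k) + del &
     a0' + A k <= a0 + a' + l / 2 * (enorm p0 ^+ 2 - enorm (P k) ^+ 2) + k%:R * (del * C)].
  elim: k => [_|k IH kN].
    exists x0', p0', a0'; rewrite X0 P0 A0; split=> //.
    by rewrite subrr mulr0 mul0r !addr0 addrC.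
  have [x' [p' [a' [hp' x'X p'P le_k]]]] := IH (ltnW kN).
  have [_ XS PS AS] := XP k; have [gS _ _ _] := XP k.+1.
  have [y' [q' [b' [hq' y'X q'P]]]] := shadow _ _ _ gS (inball _ kN) (PM _).
  exists y', q', b'; split=> //.
  have step := subgrad_le_norm hp' (subgrad_finite hq').
  have y'x' : enorm (y' - x') <= l * enorm (P k.+1) + 2 * del.
    have dX : enorm (X k.+1 - X k) = l * enorm (P k.+1).
      by rewrite XS addrAC subrr add0r enormN enormZ (gtr0_norm l0).
    have := enorm_dist y' (X k.+1) x'; have := enorm_dist (X k.+1) (X k) x'.
    by rewrite dX (enormB (X k) x'); lra.
  have Pk0 := enorm_ge0 (P k); have Pk1 := enorm_ge0 (P k.+1).
  have prod : enorm p' * enorm (y' - x') <=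
      l / 2 * (enorm (P k) ^+ 2 + enorm (P k.+1) ^+ 2) + del * C.
    apply: le_trans (ler_pM (enorm_ge0 _) (enorm_ge0 _) p'P y'x') _.
    exact: shadow_step_bound.
  rewrite -[k.+1%:R]natr1; lra.
have [|k kN small_k] := small (fun k => enorm (P k.+1)) (fun k => enorm_ge0 _).
  exact: QD.
have [x' [p' [a' [hp' x'X p'P le_k]]]] := comparison k.+1 kN.
have [gk _ _ _] := XP k.+1.
exists (X k.+1), (A k.+1); split; [by case: gk|exact: inball|].
move=> y c yK hyc; have hy := subgrad_le_norm hp' hyc.
have yx' : enorm (y - x') <= K + 1 + l * S k.+1.
  have := enorm_dist y x0 x'; have := enorm_dist x0 (X k.+1) x'.
  rewrite (enormB x0 (X k.+1)) (enormB (X k.+1) x'); have := Sdist k.+1; lra.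
have kNC : k.+1%:R * (del * C) <= N%:R * (del * C).
  by rewrite ler_pM2r ?mulr_gt0// ler_nat.
have prod : enorm p' * enorm (y - x') <= eta / 4 + del * (K + 1 + rad).
  apply: le_trans (ler_pM (enorm_ge0 _) (enorm_ge0 _) p'P yx') _.
  have : del * (K + 1 + l * S k.+1) <= del * (K + 1 + rad).
    by rewrite ler_pM2l// lerD2l; exact: Srad.
  by rewrite mulrDl; move: small_k; rewrite -/(S k.+1); lra.
have p02 : l / 2 * (enorm p0 ^+ 2 - enorm (P k.+1) ^+ 2) <= eta / 2.
  rewrite mulrAC -lM ler_pM2r// ler_pM2l//.
  have := sqr_ge0 (enorm (P k.+1)).
  have : enorm p0 ^+ 2 <= M ^+ 2 by rewrite ler_pXn2r ?nnegrE ?enorm_ge0// ltW.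
  lra.
rewrite /E in delE; lra.
Qed.

End Descent.

(** * Convergence of slopes and infima implies convergence of epigraphs *)

Section Excess.
Context {R : realType} {d : nat}.
Implicit Types (f g h : 'rV[R]_d -> \bar R) (G H : nat -> 'rV[R]_d -> \bar R).
Implicit Types (x y p q w : 'rV[R]_d) (a b c m : R).

(** One half of the convergence of epigraphs: on bounded sets, epi (G n) lies in
    arbitrarily small neighbourhoods of epi (H n).  Allowing both sides to vary
    lets each argument serve for the pair (f, f_n) and for (f_n, f). *)
Definition epi_excess_to0 G H := forall r e : R, 0 < e -> \forall n \near \oo,
  forall x a, enorm x <= r -> `|a| <= r -> (G n x <= a%:E)%E ->
    exists y b, [/\ (H n y <= b%:E)%E, enorm (y - x) <= e & `|b - a| <= e].

(** The same for slopes, phrased with subgradients: only the base point and the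
    norm of the subgradient are controlled, not its direction. *)
Definition graph_excess_to0 G H := forall r e : R, 0 < e -> \forall n \near \oo,
  forall x p a, enorm x <= r -> enorm p <= r -> subgrad (G n) x p a ->
    exists y q b, [/\ subgrad (H n) y q b, enorm (y - x) <= e &
      enorm q <= enorm p + e].

(** eventually_above and eventually_reaches together express that the infima
    of the G n converge to m, on bounded sets and along bounded points. *)
Definition eventually_above G m := forall r e : R, 0 < e -> \forall n \near \oo,
  forall x b, enorm x <= r -> (G n x <= b%:E)%E -> m - e <= b.

Definition eventually_reaches G m := forall e : R, 0 < e -> exists r : R,
  \forall n \near \oo, exists x b, [/\ enorm x <= r, (G n x <= b%:E)%E & b <= m + e].

Lemma eventually_above_excess G H m :
  epi_excess_to0 G H -> eventually_above H m -> eventually_above G m.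
Proof.
move=> gh hm r e e0; have e3 : 0 < e / 3 by lra.
pose r' := Num.max r `|m - e|.
apply: filterS2 (hm (r' + e / 3) _ e3) (gh r' _ e3) => n hmn ghn x b xr gxb.
rewrite leNgt; apply/negP => bm.
have xr' : enorm x <= r' by rewrite le_max xr.
have mr' : `|m - e| <= r' by rewrite le_max lexx orbT.
have gxm : (G n x <= (m - e)%:E)%E by rewrite (le_trans gxb)// lee_fin ltW.
have [y [c [hyc yx]]] := ghn x _ xr' mr' gxm.
rewrite ler_norml => /andP[_ ca].
have yr' : enorm y <= r' + e / 3 by have := enorm_le_dist y x; lra.
have := hmn y c yr' hyc; lra.
Qed.

Lemma eventually_reaches_excess G H m :
  epi_excess_to0 G H -> eventually_above G m -> eventually_reaches G m ->
  eventually_reaches H m.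
Proof.
move=> gh gabove greach e e0; have e2 : 0 < e / 2 by lra.
have [r gr] := greach _ e2.
pose r' := Num.max r (`|m| + e).
exists (r' + e / 2); apply: filterS3 (gabove r _ e2) gr (gh r' _ e2) => n gan.
move=> [x [b [xr gxb bm]]] ghn; have mb := gan x b xr gxb.
have xr' : enorm x <= r' by rewrite le_max xr.
have br' : `|b| <= r'.
  rewrite le_max; apply/orP; right; rewrite ler_norml.
  by have := ler_norm m; have := ler_norm (- m); rewrite normrN; lra.
have [y [c [hyc yx]]] := ghn x b xr' br' gxb.
rewrite ler_norml => /andP[_ cb].
by exists y, c; split=> //; [have := enorm_le_dist y x; lra|lra].
Qed.

(** Brondsted-Rockafellar with p = 0 moves x to a point with a subgradient,
    with a bound on the subgradient depending only on r and on how far g can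
    descend on the ball of radius r. *)
Lemma approx_by_graph g x a m r c : closed_convex g -> 0 < r -> 0 < c ->
  (g x <= a%:E)%E -> a - m <= c ->
  (forall y b, enorm (y - x) <= r -> (g y <= b%:E)%E -> m <= b) ->
  exists w p b, [/\ subgrad g w p b, enorm (w - x) < r,
    enorm p <= 2 * (c + 1) / r & b <= a].
Proof.
move=> cg r0 c0 gxa amc gm.
have [a1 gx a1a] := closed_convex_fin cg gxa.
pose l := r ^+ 2 / (2 * (c + 1)).
have c1 : 0 < 2 * (c + 1) by lra.
have l0 : 0 < l by rewrite divr_gt0// exprn_gt0.
have cl : c < r ^+ 2 / (2 * l).
  have -> : r ^+ 2 / (2 * l) = c + 1 by rewrite /l; field; lra.
  lra.
have [y b yr gyb|w [b [gw wx bw]]] := @brondsted_rockafellar R d g 0 x a1 _ r l cg l0 r0 cl gx.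
  by rewrite dot0l subr0; have := gm y b yr gyb; lra.
rewrite add0r in gw; rewrite dot0l subr0 in bw.
exists w, (l^-1 *: (x - w)), b; split=> //.
  rewrite enormZ gtr0_norm ?invr_gt0// enormB.
  have -> : 2 * (c + 1) / r = l^-1 * r by rewrite /l; field; lra.
  by rewrite ler_pM2l ?invr_gt0// ltW.
have : 0 <= enorm (w - x) ^+ 2 / (2 * l) by rewrite divr_ge0 ?sqr_ge0//; lra.
lra.
Qed.

(** Slopes and infima determine the function: after moving x to a point w with
    a subgradient of bounded norm, descent_comparison from w bounds H n near w
    by G n w plus the difference between the infima, which vanishes. *)
Theorem epi_excess_of_graph_excess G H m : (forall n, closed_convex (G n)) ->
  graph_excess_to0 G H -> eventually_above G m -> eventually_reaches H m ->
  epi_excess_to0 G H.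
Proof.
move=> cG GH Gm Hm r e e0.
have e2 : 0 < e / 2 by lra. have e4 : 0 < e / 4 by lra.
pose c0 := `|r| + `|m| + 1.
have c00 : 0 < c0 by rewrite /c0; have := normr_ge0 r; have := normr_ge0 m; lra.
have [M M0 ME] : exists2 M : R, 0 < M & M = 2 * (c0 + 1) / (e / 2).
  by eexists; [|reflexivity]; rewrite divr_gt0//; lra.
have [K Hreach] := Hm _ e4.
have K'0 : 0 <= `|K| + `|r| + e / 2 by have := normr_ge0 r; have := normr_ge0 K; lra.
have [rad [del [rad0 del0 compare]]] := @descent_comparison R d M _ c0 _ M0 K'0 (ltW c00) e4.
pose r' := Num.max (r + e / 2 + rad) M.
have del'0 : 0 < Num.min del (e / 2) by rewrite lt_min del0.
have ler' x : enorm x <= r + e / 2 + rad -> enorm x <= r' by move=> xr; rewrite le_max xr.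
have e1 : 0 < Num.min 1 (e / 4) by rewrite lt_min ltr01.
apply: filterS3 (Gm (r + e / 2 + rad) _ e1) (GH r' _ del'0) Hreach => n Gmn GHn.
move=> [y [v [yK hyv vm]]].
have Gm1 z t : enorm z <= r + e / 2 + rad -> (G n z <= t%:E)%E -> m - 1 <= t.
  have : Num.min 1 (e / 4) <= 1 by rewrite ge_min lexx.
  by move=> ? zr gzt; have := Gmn z t zr gzt; lra.
have Gm4 z t : enorm z <= r + e / 2 + rad -> (G n z <= t%:E)%E -> m - e / 4 <= t.
  have : Num.min 1 (e / 4) <= e / 4 by rewrite ge_min lexx orbT.
  by move=> ? zr gzt; have := Gmn z t zr gzt; lra.
move=> x a xr ar gxa.
have [||w [p [b [gw wx pM ba]]]] := @approx_by_graph (G n) x a (m - 1) (e / 2) c0 (cG n) e2 c00 gxa.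
- have := ler_norm r; have := ler_norm (- m); rewrite normrN.
  by have := ler_norm a; rewrite /c0; lra.
- move=> z b zx gzb; apply: (Gm1 z b _ gzb).
  by have := enorm_le_dist z x; lra.
rewrite -ME in pM.
have wr : enorm w <= r + e / 2 by have := enorm_le_dist w x; lra.
have shadow z q t : subgrad (G n) z q t -> enorm (z - w) <= rad -> enorm q <= M ->
    exists z' q' t', [/\ subgrad (H n) z' q' t', enorm (z' - z) <= Num.min del (e / 2) &
      enorm q' <= enorm q + Num.min del (e / 2)].
  move=> gz zw qM; apply: (GHn z q t) => //; last by rewrite le_max qM orbT.
  by apply: ler'; have := enorm_le_dist z w; lra.
have mindel : Num.min del (e / 2) <= del by rewrite ge_min lexx.
have mine : Num.min del (e / 2) <= e / 2 by rewrite ge_min lexx orbT.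
have [|w' [p' [b' [hw' w'w p'p]]]] := shadow w p b gw _ pM.
  by rewrite subrr enorm0.
have [||||z [t [gz zw le_t]]] := compare (G n) (H n) w p b w' p' b' (cG n) gw pM _ _ hw'.
- move=> z t zw gzt; have zr : enorm z <= r + e / 2 + rad.
    by have := enorm_le_dist z w; lra.
  have := Gm1 z t zr gzt; have := ler_norm a; have := ler_norm r.
  by have := ler_norm (- m); rewrite normrN /c0; lra.
- move=> z q t gz zw qM; have [z' [q' [t' [? z'z q'q]]]] := shadow z q t gz zw qM.
  by exists z', q', t'; split=> //; lra.
- lra.
- lra.
have zr : enorm z <= r + e / 2 + rad by have := enorm_le_dist z w; lra.
have gm : m - e / 4 <= t by apply: (Gm4 z) => //; rewrite gz.
have wr0 : enorm (y - w) <= `|K| + `|r| + e / 2.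
  have := enorm_dist y 0 w; rewrite subr0 sub0r enormN.
  by have := ler_norm K; have := ler_norm r; lra.
have hw'e := le_t y v wr0 hyv.
exists w', (a + e); split.
- by case: hw' => -> _; rewrite lee_fin; lra.
- by have := enorm_dist w' w x; lra.
- by rewrite (addrC a) addrK gtr0_norm.
Qed.

End Excess.

(** * Convergence of epigraphs implies convergence of subgradients *)

Section Attouch.
Context {R : realType} {d : nat}.
Implicit Types (f g h : 'rV[R]_d -> \bar R) (G H : nat -> 'rV[R]_d -> \bar R).
Implicit Types (x y p q w : 'rV[R]_d) (a b c m : R).

(** If the epigraphs of g and h are close, a subgradient p of g at x is an
    approximate subgradient of h at a nearby point, and Brondsted-Rockafellar
    makes it exact. *)
Lemma subgrad_transfer (M eta : R) : 0 <= M -> 0 < eta ->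
  exists2 del : R, 0 < del & forall g h x p a,
    closed_convex h -> subgrad g x p a -> enorm p <= M ->
    (exists y b, [/\ (h y <= b%:E)%E, enorm (y - x) <= del & `|b - a| <= del]) ->
    (forall y b, enorm (y - x) <= 2 -> `|b - a| <= 2 * M + 1 -> (h y <= b%:E)%E ->
       exists z c, [/\ (g z <= c%:E)%E, enorm (z - y) <= del & `|c - b| <= del]) ->
    exists w q b, [/\ subgrad h w q b, enorm (w - x) <= eta, enorm (q - p) <= eta &
      `|b - a| <= eta].
Proof.
move=> M0 eta0; have M2 : 0 < 2 + M by lra.
have [s [s0 s1 sM]] : exists s : R, [/\ 0 < s, s <= 1 / 2 & 2 * (M + 1) * s <= eta / 2].
  exists (Num.min (1 / 2) (eta / (4 * (M + 1)))); split.
  - by rewrite lt_min !divr_gt0//; lra.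
  - by rewrite ge_min lexx.
  - apply: (@le_trans _ _ (2 * (M + 1) * (eta / (4 * (M + 1))))).
      by rewrite ler_pM2l; [rewrite ge_min lexx orbT|lra].
    by rewrite le_eqVlt; apply/orP; left; apply/eqP; field; lra.
(* The resulting error of p as a subgradient is 2 (2 + M) e, and it must stay
   below s^2 / 2 for the minimizer to be within s. *)
have [e [e0 eE es]] : exists e : R, [/\ 0 < e, (2 + M) * e = s ^+ 2 / 8 & e <= s / 16].
  have s20 : 0 < s ^+ 2 by rewrite exprn_gt0.
  exists (s ^+ 2 / 8 / (2 + M)); split.
  - by rewrite !divr_gt0.
  - by rewrite mulrC divfK// gt_eqF.
  - rewrite ler_pdivrMr//.
    have : s * s <= s * (1 / 2) by rewrite ler_pM2l.
    by have : 0 <= s * M by [rewrite mulr_ge0// ltW]; lra.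
have se : 8 * ((2 + M) * e) <= s / 2.
  have : s * s <= s * (1 / 2) by rewrite ler_pM2l.
  by rewrite eE; lra.
have Me0 : 0 <= M * e by rewrite mulr_ge0// ltW.
exists e => // g h x p a ch gp pM [y0 [b0 [hy0 y0x b0a]]] hg.
have p0 := enorm_ge0 p.
have dotM q v c : enorm v <= c -> enorm q <= M -> - (M * c) <= dot q v <= M * c.
  move=> vc qM; have := cauchy_schwarz q v; have := cauchy_schwarzN q v.
  by have := ler_pM (enorm_ge0 q) (enorm_ge0 v) qM vc; lra.
(* Up to an error of order e, p is a subgradient of h at x on a ball. *)
have almost y b : enorm (y - x) <= 2 -> (h y <= b%:E)%E ->
    a + dot p (y - x) - (2 + M) * e <= b.
  move=> yx hyb; rewrite leNgt; apply/negP; set t := _ - _ => bt.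
  have ta : `|t - a| <= 2 * M + 1.
    by have /andP[] := dotM p _ _ yx pM; rewrite ler_norml /t; lra.
  have [|z [c [gzc zy]]] := hg y t yx ta; first by rewrite (le_trans hyb)// lee_fin ltW.
  rewrite ler_norml => /andP[_ ct].
  have [_ /(_ z c gzc)] := gp.
  rewrite -(subrKA y z) dotDr; have /andP[+ _] := dotM p _ _ zy pM.
  by rewrite /t in ct; lra.
have [b1 hy0b1 b1b0] := closed_convex_fin ch hy0.
have cs : 2 * ((2 + M) * e) < s ^+ 2 / (2 * 1).
  by have : 0 < s ^+ 2 by [rewrite exprn_gt0]; lra.
move: b0a; rewrite ler_norml => /andP[_ b0a].
have [y b ys hyb|w [b [hw wy0 bw]]] := @brondsted_rockafellar R d h p y0 b1 _ s 1 ch ltr01 s0 cs hy0b1.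
  have yx : enorm (y - x) <= 2 by have := enorm_dist y y0 x; lra.
  have := almost y b yx hyb.
  rewrite -(subrKA y0 y) (dotDr p (y - y0)); have /andP[+ _] := dotM p _ _ y0x pM; lra.
rewrite invr1 scale1r in hw.
have wx : enorm (w - x) <= s + e by have := enorm_dist w y0 x; lra.
exists w, (p + (y0 - w)), b; split=> //.
- by have : 0 <= M * s by [rewrite mulr_ge0// ltW]; lra.
- rewrite addrAC subrr add0r enormB.
  by have : 0 <= M * s by [rewrite mulr_ge0// ltW]; lra.
- have Ms : 0 <= M * s by rewrite mulr_ge0// ltW.
  have sq : 0 <= enorm (w - y0) ^+ 2 / (2 * 1) by rewrite divr_ge0 ?sqr_ge0//; lra.
  have wx2 : enorm (w - x) <= 2 by lra.
  have lo := almost w b wx2 (subgrad_finite hw).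
  have /andP[d1 _] := dotM p _ _ wx pM.
  have /andP[_ d2] := dotM p _ _ (ltW wy0) pM.
  by rewrite ler_norml; lra.
Qed.

Lemma subgrad_transfer_near G H (r eta : R) : 0 < eta ->
  (forall n, closed_convex (H n)) ->
  epi_excess_to0 G H -> epi_excess_to0 H G ->
  \forall n \near \oo, forall x p a, enorm x <= r -> enorm p <= r -> `|a| <= r ->
    subgrad (G n) x p a ->
    exists w q b, [/\ subgrad (H n) w q b, enorm (w - x) <= eta, enorm (q - p) <= eta &
      `|b - a| <= eta].
Proof.
move=> eta0 cH GH HG; have [del del0 transfer] := subgrad_transfer (normr_ge0 r) eta0.
apply: filterS2 (GH r _ del0) (HG (3 * `|r| + 2) _ del0) => n GHn HGn x p a xr pr ar gx.
have rr := ler_norm r; have r0 := normr_ge0 r.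
apply: (transfer (G n) (H n)) => //.
- exact: le_trans rr.
- exact: GHn xr ar (subgrad_finite gx).
move=> y b yx ba hyb; apply: HGn hyb.
  by have := enorm_le_dist y x; lra.
by move: ba ar; rewrite !ler_norml; lra.
Qed.

(** Subgradients of bounded norm at bounded points also have bounded function
    values, because G n is bounded below there and reaches m at bounded
    points; so subgrad_transfer applies uniformly. *)
Theorem graph_excess_of_epi_excess G H m : (forall n, closed_convex (H n)) ->
  epi_excess_to0 G H -> epi_excess_to0 H G ->
  eventually_above G m -> eventually_reaches G m -> graph_excess_to0 G H.
Proof.
move=> cH GH HG Gm Gr r e e0; have [K GK] := Gr 1 ltr01.
pose r' := `|r| + `|m| + 1 + `|r| * (`|K| + `|r|).
have r0 := normr_ge0 r; have m0 := normr_ge0 m; have K0 := normr_ge0 K.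
have rK0 : 0 <= `|r| * (`|K| + `|r|) by rewrite mulr_ge0//; lra.
apply: filterS3 (Gm r 1 ltr01) GK (subgrad_transfer_near r' e0 cH GH HG).
move=> n Gmn [y [b [yK gyb bm]]] transfer x p a xr pr gx.
have rr := ler_norm r.
have ar' : `|a| <= r'.
  rewrite ler_norml; have := Gmn x a xr (subgrad_finite gx).
  have := subgrad_le_norm gx gyb; have := ler_norm m; have := ler_norm (- m).
  have yx : enorm (y - x) <= `|K| + `|r|.
    by have := enormD y (- x); rewrite enormN; have := ler_norm K; lra.
  have := ler_pM (enorm_ge0 p) (enorm_ge0 (y - x)) (le_trans pr rr) yx.
  by rewrite normrN /r'; lra.
have [||w [q [c [hw wx qp _]]]] := transfer x p a _ _ ar' gx; [by rewrite /r'; lra..|].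
exists w, q, c; split=> //; have := enorm_le_dist q p; lra.
Qed.

End Attouch.

(** * A normalization condition forces convergence of the infima *)

Section Normalization.
Context {R : realType} {d : nat}.
Implicit Types (f g h : 'rV[R]_d -> \bar R) (G H : nat -> 'rV[R]_d -> \bar R).
Implicit Types (x y p q w : 'rV[R]_d) (a b c m : R).

Definition normalized_at G x p a := forall e : R, 0 < e -> \forall n \near \oo,
  exists x' p' a', [/\ subgrad (G n) x' p' a', enorm (x' - x) <= e,
    enorm (p' - p) <= e & `|a' - a| <= e].

(** Descending along f from x, where f and G n almost agree, the comparison
    principle ends with G n y >= f z - eta for some z. *)
Lemma eventually_above_of_normalized f G x p a m : closed_convex f ->
  (forall y b, (f y <= b%:E)%E -> m <= b) -> subgrad f x p a ->
  normalized_at G x p a -> graph_excess_to0 (fun=> f) G -> eventually_above G m.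
Proof.
move=> cf mf fx Gx fG r e e0; have e2 : 0 < e / 2 by lra.
have p0 := enorm_ge0 p; have x0 := enorm_ge0 x; have r0 := normr_ge0 r.
have M0 : 0 < enorm p + 1 by lra.
have D0 : 0 <= a - m by rewrite subr_ge0; exact: mf (subgrad_finite fx).
have K0 : 0 <= `|r| + enorm x by lra.
have [rad [del [rad0 del0 compare]]] := @descent_comparison R d _ _ _ _ M0 K0 D0 e2.
pose r' := enorm x + rad + (enorm p + 1).
have e'0 : 0 < Num.min del (e / 2) by rewrite lt_min del0.
apply: filterS2 (Gx _ e'0) (fG r' _ del0) => n.
move=> [x' [p' [a' [gx' x'x p'p]]]]; rewrite ler_norml => /andP[a'a _] shadow.
have mindel : Num.min del (e / 2) <= del by rewrite ge_min lexx.
have mine : Num.min del (e / 2) <= e / 2 by rewrite ge_min lexx orbT.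
move=> y c yr gyc.
have [|||||z [t [fz zx le_t]]] := compare f (G n) x p a x' p' a' cf fx _ _ _ gx'.
- by rewrite lerDl.
- by move=> z b _ /mf; rewrite subKr.
- move=> z q t fz zx qM; apply: (shadow z q t) => //; rewrite /r'; last by lra.
  by have := enorm_le_dist z x; lra.
- exact: le_trans mindel.
- by have := enorm_le_dist p' p; lra.
have yx : enorm (y - x) <= `|r| + enorm x.
  by have := enormD y (- x); rewrite enormN; have := ler_norm r; lra.
have := le_t y c yx gyc; have mt : m <= t by apply: (mf z); rewrite fz.
by lra.
Qed.

(** Descending along G n instead and comparing with f gives a point z, at
    bounded distance, with G n z <= f y + eta for y nearly minimizing f. *)
Lemma eventually_reaches_of_normalized f G x p a m :
  (forall n, closed_convex (G n)) ->
  (forall e : R, 0 < e -> exists y b, (f y <= b%:E)%E /\ b <= m + e) ->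
  m <= a -> subgrad f x p a -> normalized_at G x p a ->
  graph_excess_to0 G (fun=> f) -> eventually_above G m -> eventually_reaches G m.
Proof.
move=> cG fm ma fx Gx Gf Gm e e0; have e4 : 0 < e / 4 by lra.
have p0 := enorm_ge0 p; have x0 := enorm_ge0 x.
have [y [b [fyb bm]]] := fm _ e4; have y0 := enorm_ge0 y.
have M0 : 0 < enorm p + 1 by lra.
have D0 : 0 <= a - m + 2 by lra.
have K0 : 0 <= enorm y + enorm x + 1 by lra.
have [rad [del [rad0 del0 compare]]] := @descent_comparison R d _ _ _ _ M0 K0 D0 e4.
pose r' := enorm x + 1 + rad + (enorm p + 1).
have [e' [e'0 e'del e'1 e'e]] : exists e' : R, [/\ 0 < e', e' <= del, e' <= 1 & e' <= e / 4].
  exists (Num.min del (Num.min 1 (e / 4))).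
  by rewrite !lt_min del0 ltr01 e4 !ge_min !lexx !orbT.
exists r'; apply: filterS3 (Gx _ e'0) (Gf r' _ del0) (Gm r' _ ltr01) => n.
move=> [x' [p' [a' [gx' x'x p'p]]]]; rewrite ler_norml => /andP[_ a'a] shadow above.
have x'r : enorm x' <= enorm x + 1 by have := enorm_le_dist x' x; lra.
have [|||||z [t [gz zx le_t]]] := compare (G n) f x' p' a' x p a (cG n) gx' _ _ _ fx.
- by have := enorm_le_dist p' p; lra.
- move=> z v zx' gzv; have := above z v _ gzv.
  by have := enorm_le_dist z x'; rewrite /r' => ? /(_ ltac:(lra)); lra.
- move=> z q t gz zx' qM; apply: (shadow z q t) => //; rewrite /r'; last by lra.
  by have := enorm_le_dist z x'; lra.
- by rewrite enormB; lra.
- by have := enorm_le_dist p p'; rewrite (enormB p); lra.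
have yx' : enorm (y - x') <= enorm y + enorm x + 1.
  by have := enormD y (- x'); rewrite enormN; lra.
have := le_t y b yx' fyb => le_ab.
exists z, t; split; [|by rewrite gz|by lra].
by rewrite /r'; have := enorm_le_dist z x'; lra.
Qed.

End Normalization.

(** * Upper and lower limits, and Painleve-Kuratowski convergence *)

Section UpperLowerLimits.
Context {R : realType}.
Implicit Types (u : nat -> \bar R) (c : \bar R).

Lemma limn_esup_lt u c : (limn_esup u < c)%E -> \forall n \near \oo, (u n < c)%E.
Proof.
move=> /ereal_inf_lt[_ [V VN <-] Vc]; apply: filterS VN => n Vn.
by apply: le_lt_trans Vc; apply: ereal_sup_ubound; exists n.
Qed.

Lemma limn_esup_le u c : (\forall n \near \oo, (u n <= c)%E) -> (limn_esup u <= c)%E.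
Proof.
move=> uc; apply: (@le_trans _ _ (ereal_sup (u @` [set n | (u n <= c)%E]))).
  by apply: ereal_inf_lbound; exists [set n | (u n <= c)%E].
by apply: ge_ereal_sup => _ [n /= unc <-].
Qed.

Lemma limn_einf_ge u c : (\forall n \near \oo, (c <= u n)%E) -> (c <= limn_einf u)%E.
Proof.
move=> cu; rewrite /limn_einf leeNr; apply: limn_esup_le.
by apply: filterS cu => n cun; rewrite leeN2.
Qed.

Lemma limn_einf_gt u c : (c < limn_einf u)%E -> \forall n \near \oo, (c < u n)%E.
Proof.
rewrite /limn_einf lteNr => /limn_esup_lt; apply: filterS => n.
by rewrite lteN2.
Qed.

Lemma limn_einf_le u c : (forall N, exists2 n, (N <= n)%N & (u n <= c)%E) ->
  (limn_einf u <= c)%E.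
Proof.
move=> uc; rewrite leNgt; apply/negP => /limn_einf_gt[N _ cu].
have [n Nn unc] := uc N; have := lt_le_trans (cu n Nn) unc.
by rewrite ltxx.
Qed.

Lemma limn_einf_lt u c : (limn_einf u < c)%E ->
  forall N, exists2 n, (N <= n)%N & (u n < c)%E.
Proof.
move=> uc N; apply: contrapT => noN; move: uc; apply/negP; rewrite -leNgt.
apply: limn_einf_ge; exists N => // n Nn; rewrite leNgt.
by apply/negP => unc; apply: noN; exists n.
Qed.

Lemma limn_esup0P u : (forall n, 0 <= u n)%E ->
  limn_esup u = 0%E <-> forall e : R, 0 < e -> \forall n \near \oo, (u n < e%:E)%E.
Proof.
move=> u0; split=> [uE e e0|ue].
  by apply: limn_esup_lt; rewrite uE lte_fin.
apply/eqP; rewrite eq_le; apply/andP; split; last first.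
  by apply: le_trans (limn_einf_sup u); apply: limn_einf_ge; exact: nearW.
apply/lee_addgt0Pr => e e0; rewrite add0e; apply: limn_esup_le.
by apply: filterS (ue e e0) => n /ltW.
Qed.

Lemma limn_einf0P u : (forall n, 0 <= u n)%E ->
  limn_einf u = 0%E <-> forall e : R, 0 < e ->
    forall N, exists2 n, (N <= n)%N & (u n < e%:E)%E.
Proof.
move=> u0; split=> [uE e e0|ue].
  by apply: limn_einf_lt; rewrite uE lte_fin.
apply/eqP; rewrite eq_le; apply/andP; split; last first.
  by apply: limn_einf_ge; exact: nearW.
apply/lee_addgt0Pr => e e0; rewrite add0e; apply: limn_einf_le => N.
by have [n Nn /ltW une] := ue e e0 N; exists n.
Qed.

End UpperLowerLimits.

Section PainleveKuratowski.
Context {R : realType} {d : nat}.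
Implicit Types (z w : 'rV[R]_d * R) (C : set ('rV[R]_d * R)).
Implicit Types (phi psi : 'rV[R]_d -> \bar R).

(** Bounding the two components separately is equivalent, up to a constant
    factor, to bounding the product norm used by dist_prod, and combines better
    with estimates on points and on values. *)
Definition box_close (e : R) z w := enorm (w.1 - z.1) <= e /\ `|w.2 - z.2| <= e.

Definition near_set C z e := exists2 w, C w & box_close e z w.

Lemma dist_prod_ge0 z C : (0 <= dist_prod z C)%E.
Proof. by apply: le_ereal_inf_tmp => _ [w _ <-]; rewrite lee_fin sqrtr_ge0. Qed.

Lemma near_set_of_dist z C (e : R) : (dist_prod z C < e%:E)%E -> near_set C z e.
Proof.
move=> /ereal_inf_lt[_ [w Cw <-]]; rewrite lte_fin /enorm_prod => ze.
have e0 : 0 <= e by apply: le_trans (ltW ze); exact: sqrtr_ge0.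
have s0 : 0 <= enorm (z - w).1 ^+ 2 + (z - w).2 ^+ 2 by rewrite addr_ge0 ?sqr_ge0.
have {ze} : enorm (z - w).1 ^+ 2 + (z - w).2 ^+ 2 < e ^+ 2.
  by rewrite -(sqr_sqrtr s0) ltr_pXn2r ?nnegrE ?sqrtr_ge0.
have := sqr_ge0 (enorm (z - w).1); have := sqr_ge0 (z - w).2 => h1 h2 h3.
exists w => //; split.
  rewrite enormB -(@ler_pXn2r _ 2)// ?nnegrE ?enorm_ge0//; lra.
rewrite distrC -(@ler_pXn2r _ 2)// ?nnegrE// real_normK ?num_real//; lra.
Qed.

Lemma dist_of_near_set z C (e : R) : 0 < e -> near_set C z (e / 4) ->
  (dist_prod z C < e%:E)%E.
Proof.
move=> e0 [w Cw [w1 w2]].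
apply: (@le_lt_trans _ _ (enorm_prod (z - w))%:E).
  by apply: ereal_inf_lbound; exists w.
rewrite lte_fin -(@ltr_pXn2r _ 2)// ?nnegrE ?sqrtr_ge0 ?(ltW e0)//.
rewrite sqr_sqrtr ?addr_ge0 ?sqr_ge0//.
have e4 : 0 <= e / 4 by lra.
have : enorm (z - w).1 ^+ 2 <= (e / 4) ^+ 2.
  by rewrite ler_pXn2r ?nnegrE ?enorm_ge0// enormB.
have : (z - w).2 ^+ 2 <= (e / 4) ^+ 2.
  by rewrite -[leLHS]real_normK ?num_real// ler_pXn2r ?nnegrE// distrC.
have : 0 < e ^+ 2 by rewrite exprn_gt0.
lra.
Qed.

Lemma pk_cvgP (C_ : nat -> set ('rV[R]_d * R)) C : pk_cvg C_ C <->
  (forall z, C z <-> forall e : R, 0 < e ->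
     forall N, exists2 n, (N <= n)%N & near_set (C_ n) z e) /\
  (forall z, C z <-> forall e : R, 0 < e ->
     \forall n \near \oo, near_set (C_ n) z e).
Proof.
have infP z : limn_einf (fun n => dist_prod z (C_ n)) = 0%E <->
    forall e : R, 0 < e -> forall N, exists2 n, (N <= n)%N & near_set (C_ n) z e.
  rewrite limn_einf0P; last by move=> n; exact: dist_prod_ge0.
  split=> h e e0 N.
    by have [n Nn /near_set_of_dist] := h e e0 N; exists n.
  have e4 : 0 < e / 4 by lra.
  by have [n Nn /(dist_of_near_set e0)] := h _ e4 N; exists n.
have supP z : limn_esup (fun n => dist_prod z (C_ n)) = 0%E <->
    forall e : R, 0 < e -> \forall n \near \oo, near_set (C_ n) z e.
  rewrite limn_esup0P; last by move=> n; exact: dist_prod_ge0.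
  split=> h e e0.
    by apply: filterS (h e e0) => n; exact: near_set_of_dist.
  have e4 : 0 < e / 4 by lra.
  by apply: filterS (h _ e4) => n; exact: dist_of_near_set.
split=> [[inner outer]|[inner outer]].
  by split=> z; [rewrite -infP -inner|rewrite -supP {1}outer].
by split; apply/seteqP; split=> z /=; rewrite ?infP ?supP -?inner -?outer.
Qed.

Lemma near_box_close z (e : R) : 0 < e -> \forall z' \near z, box_close e z z'.
Proof.
move=> e0; case: z => x a.
exists ([set y | enorm (y - x) <= e], [set b | `|b - a| <= e]) => /=; last first.
  by move=> [y b] [].
split=> /=.
  by apply/nbhs_enormP; exists e => // y /ltW.
apply/nbhs_ballP; exists e => // b; rewrite -ball_normE /ball_ /= distrC.
exact: ltW.
Qed.

Lemma box_close_sym e z w : box_close e z w -> box_close e w z.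
Proof. by rewrite /box_close enormB distrC. Qed.

Lemma box_close_trans e1 e2 z w v : box_close e1 z w -> box_close e2 w v -> box_close (e1 + e2) z v.
Proof.
move=> [w1 w2] [v1 v2]; split; first by have := enorm_dist v.1 w.1 z.1; lra.
by have := ler_distD w.2 v.2 z.2; lra.
Qed.

Lemma box_compact (r : R) : compact [set z : 'rV[R]_d * R | enorm z.1 <= r /\ `|z.2| <= r].
Proof.
have -> : [set z : 'rV[R]_d * R | enorm z.1 <= r /\ `|z.2| <= r] =
    [set x | enorm (x - 0) <= r] `*` `[- r, r].
  apply/seteqP; split=> z /=; rewrite subr0 in_itv/= ler_norml;
  by move=> [? ?]; split.
by apply: compact_setX; [exact: enorm_ball_compact|exact: segment_compact].
Qed.

Definition epi_closed phi := forall z,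
  (forall e : R, 0 < e -> near_set (epi phi) z e) -> epi phi z.

(** Painleve-Kuratowski convergence is a pointwise condition; compactness of the
    box makes both inclusions uniform on bounded sets.  Points outside epi phi
    have a neighbourhood that epi phi, for the first inclusion, or epi (phi_ n),
    for the second, does not meet. *)
Lemma epi_excess_of_cvg (phi_ : nat -> 'rV[R]_d -> \bar R) phi :
  epi_cvg phi_ phi ->
  epi_excess_to0 (fun=> phi) phi_ /\ epi_excess_to0 phi_ (fun=> phi).
Proof.
move=> /pk_cvgP[outer inner].
suff [inX outX] : (forall r e : R, 0 < e -> \forall n \near \oo,
    [set z : 'rV[R]_d * R | enorm z.1 <= r /\ `|z.2| <= r] `<=`
    [set z | epi phi z -> near_set (epi (phi_ n)) z e]) /\
    (forall r e : R, 0 < e -> \forall n \near \oo,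
    [set z : 'rV[R]_d * R | enorm z.1 <= r /\ `|z.2| <= r] `<=`
    [set z | epi (phi_ n) z -> near_set (epi phi) z e]).
  split=> r e e0.
    apply: filterS (inX r e e0) => n sub x a xr ar xa.
    by have [|[y b] yb [yx ba]] := sub (x, a) _ xa; [|exists y, b].
  apply: filterS (outX r e e0) => n sub x a xr ar xa.
  by have [|[y b] yb [yx ba]] := sub (x, a) _ xa; [|exists y, b].
split=> r e e0; have e2 : 0 < e / 2 by lra.
  have /compact_near_coveringP cover := @box_compact r.
  apply: (cover nat \oo (fun n z => epi phi z -> near_set (epi (phi_ n)) z e)) => z _.
  have [phiz|phiz] := pselect (epi phi z).
    have near_n := (iffLR (inner z) phiz) _ e2.
    near=> z' n => _.
    have [w phiw zw] : near_set (epi (phi_ n)) z (e / 2) by near: n.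
    exists w => //; rewrite (splitr e); apply: box_close_trans zw; apply: box_close_sym.
    by near: z'; exact: near_box_close.
  have [e1 e10 not_near] : exists2 e1 : R, 0 < e1 & ~ \forall n \near \oo, near_set (epi (phi_ n)) z e1.
    apply: contrapT => h; apply: phiz; apply/inner => e1 e10; apply: contrapT => h1.
    by apply: h; exists e1.
  have e12 : 0 < e1 / 2 by lra.
  near=> z' n => phiz'; exfalso; apply: not_near.
  apply: filterS ((iffLR (inner z') phiz') _ e12) => k [w phiw z'w].
  exists w => //; rewrite (splitr e1); apply: box_close_trans z'w.
  by near: z'; exact: near_box_close.
have /compact_near_coveringP cover := @box_compact r.
apply: (cover nat \oo (fun n z => epi (phi_ n) z -> near_set (epi phi) z e)) => z _.
have [phiz|phiz] := pselect (epi phi z).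
  near=> z' n => _; exists z => //; apply: box_close_sym.
  by near: z'; exact: near_box_close.
have [e1 [e10 [N farN]]] : exists e1 : R, 0 < e1 /\ exists N, forall n, (N <= n)%N -> ~ near_set (epi (phi_ n)) z e1.
  apply: contrapT => h; apply: phiz; apply/outer => e1 e10 N; apply: contrapT => h1.
  apply: h; exists e1; split=> //; exists N => n Nn zn; apply: h1.
  by exists n.
near=> z' n => phiz'; exfalso; apply: (farN n).
  by near: n; exists N.
by exists z' => //; near: z'; exact: near_box_close.
Unshelve. all: by end_near. Qed.

Lemma epi_cvg_of_excess (phi_ : nat -> 'rV[R]_d -> \bar R) phi : epi_closed phi ->
  epi_excess_to0 (fun=> phi) phi_ -> epi_excess_to0 phi_ (fun=> phi) ->
  epi_cvg phi_ phi.
Proof.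
move=> cphi inX outX.
have inner z : epi phi z -> forall e : R, 0 < e -> \forall n \near \oo, near_set (epi (phi_ n)) z e.
  case: z => x a xa e e0.
  apply: filterS (inX (Num.max (enorm x) `|a|) e e0) => n sub.
  by have [||y [b [yb yx ba]]] := sub x a _ _ xa; rewrite ?le_max ?lexx ?orbT//; exists (y, b).
have near_often z : (forall e : R, 0 < e -> \forall n \near \oo, near_set (epi (phi_ n)) z e) ->
    forall e : R, 0 < e -> forall N, exists2 n, (N <= n)%N & near_set (epi (phi_ n)) z e.
  move=> h e e0 N; have [k _ hk] := h e e0.
  by exists (maxn N k); [rewrite leq_maxl|apply: hk; rewrite /= leq_maxr].
have outer z : (forall e : R, 0 < e -> forall N, exists2 n, (N <= n)%N & near_set (epi (phi_ n)) z e) ->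
    epi phi z.
  move=> often; apply: cphi => e e0; have e2 : 0 < e / 2 by lra.
  have [N _ sub] := outX (enorm z.1 + `|z.2| + e) _ e2.
  have [n Nn [w phiw zw]] := often _ e2 N; have [w1 w2] := zw.
  have z10 := enorm_ge0 z.1; have z20 := normr_ge0 z.2.
  have [||y [b [yb yw bw]]] := sub n Nn w.1 w.2 _ _ phiw.
  - by have := enorm_le_dist w.1 z.1; lra.
  - by have := ler_normD z.2 (w.2 - z.2); rewrite addrC subrK; lra.
  by exists (y, b) => //; rewrite (splitr e); apply: box_close_trans zw _.
apply/pk_cvgP; split=> z; split.
- by move=> /inner/near_often.
- exact: outer.
- exact: inner.
- by move=> /near_often/outer.
Qed.

End PainleveKuratowski.

(** * Slopes *)

(** Choosing t within 1 / (n + 1) of the least possible error turns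
    a condition of the form: for every e, eventually some t has error at most e,
    into a single sequence. *)
Lemma near_optimal_selection (R : realType) (T : Type) (A : nat -> T -> Prop)
    (err : nat -> T -> R) :
  (forall n t, 0 <= err n t) -> (forall n, exists t, A n t) ->
  (forall e : R, 0 < e -> \forall n \near \oo, exists2 t, A n t & err n t <= e) ->
  exists2 u, forall n, A n (u n) &
    forall e : R, 0 < e -> \forall n \near \oo, err n (u n) <= e.
Proof.
move=> err0 A0 small; pose E n := err n @` A n.
have Elb n : has_lbound (E n) by exists 0 => _ [t _ <-].
have Einf n : has_inf (E n).
  by split=> //; have [t At] := A0 n; exists (err n t), t.
have pick n : exists t, A n t /\ err n t <= inf (E n) + n.+1%:R^-1.
  have [|_ [t At <-] /ltW le_t] := @inf_adherent R (E n) n.+1%:R^-1 _ (Einf n).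
    by rewrite invr_gt0.
  by exists t.
have [u uP] := choice pick; exists u => [n|e e0]; first by case: (uP n).
have e2 : 0 < e / 2 by lra.
near=> n; have [_ /le_trans] := uP n; apply.
have [t At te] : exists2 t, A n t & err n t <= e / 2 by near: n; exact: small.
have le1 : inf (E n) <= err n t by apply: ge_inf => //; exists t.
have le2 : n.+1%:R^-1 <= e / 2 by apply: ltW; near: n; exact: near_infty_natSinv_lt (PosNum e2).
by rewrite (splitr e); apply: lerD => //; exact: le_trans te.
Unshelve. all: by end_near. Qed.

Section Slope.
Context {R : realType} {d : nat}.
Implicit Types (f g h : 'rV[R]_d -> \bar R) (G H : nat -> 'rV[R]_d -> \bar R).
Implicit Types (x y p q w : 'rV[R]_d) (a b c m : R).

Lemma slope_le f x p a : closed_convex f -> subgrad f x p a ->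
  (slope f x <= (enorm p)%:E)%E.
Proof.
move=> cf fx; apply: ereal_inf_lbound; exists p => //.
by apply/closed_convex_subdiffP => //; exists a.
Qed.

Lemma slope_lt f x c : closed_convex f -> (slope f x < c%:E)%E ->
  exists p a, subgrad f x p a /\ enorm p < c.
Proof.
move=> cf /ereal_inf_lt[_ [p fp <-]]; rewrite lte_fin => pc.
by have [a fx] := (iffLR (closed_convex_subdiffP _ _ cf) fp); exists p, a.
Qed.

Lemma graph_excess_of_slope_excess G H :
  (forall n, closed_convex (G n)) -> (forall n, closed_convex (H n)) ->
  epi_excess_to0 (fun n => slope (G n)) (fun n => slope (H n)) ->
  graph_excess_to0 G H.
Proof.
move=> cG cH GH r e e0; have e2 : 0 < e / 2 by lra.
apply: filterS (GH r _ e2) => n sub x p a xr pr gx.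
have pr' : `|enorm p| <= r by rewrite ger0_norm// enorm_ge0.
have [y [b [hyb yx]]] := sub x (enorm p) xr pr' (slope_le (cG n) gx).
rewrite ler_norml => /andP[_ bp].
have [|q [c [hy qb]]] := @slope_lt (H n) y (b + e / 2) (cH n).
  by rewrite (le_lt_trans hyb)// lte_fin; lra.
by exists y, q, c; split=> //; lra.
Qed.

Lemma slope_excess_of_graph_excess G H :
  (forall n, closed_convex (G n)) -> (forall n, closed_convex (H n)) ->
  graph_excess_to0 G H ->
  epi_excess_to0 (fun n => slope (G n)) (fun n => slope (H n)).
Proof.
move=> cG cH GH r e e0; have e2 : 0 < e / 2 by lra.
apply: filterS (GH (r + e / 2) _ e2) => n sub x a xr ar gxa.
have [|p [c [gx pa]]] := @slope_lt (G n) x (a + e / 2) (cG n).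
  by rewrite (le_lt_trans gxa)// lte_fin; lra.
have [||y [q [b [hy yx qp]]]] := sub x p c _ _ gx; first by lra.
  by have := ler_norm a; lra.
exists y, (a + e); split; [|lra|by rewrite (addrC a) addrK gtr0_norm].
by apply: le_trans (slope_le (cH n) hy) _; rewrite lee_fin; lra.
Qed.

Lemma closed_convex_epi_closed f : closed_convex f -> epi_closed f.
Proof.
move=> [_ _ lf] [x a] fxa; rewrite /epi /= leNgt; apply/negP.
move=> /ereal_lt_real[b /andP[]]; rewrite lte_fin => ab /lf[V /nbhs_enormP[e e0 xV] Vb].
have e'0 : 0 < Num.min (e / 2) (b - a) by rewrite lt_min subr_gt0 ab divr_gt0.
have [[y c] fyc [yx]] := fxa _ e'0.
rewrite /= le_min in yx; case/andP: yx => yx _.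
rewrite /= le_min => /andP[_]; rewrite ler_norml => /andP[_ ca].
have /Vb : V y by apply: xV; lra.
move=> /lt_le_trans /(_ fyc); rewrite lte_fin /=; lra.
Qed.

(** Closedness of the graph of the subdifferential, in the form suited to a
    covering argument: the failure of the subgradient inequality against some z
    is an open condition, f being lower semicontinuous. *)
Lemma not_subgrad_near f x p : closed_convex f -> (forall a, ~ subgrad f x p a) ->
  exists2 e : R, 0 < e & forall y q a, enorm (y - x) < e -> enorm (q - p) < e ->
    ~ subgrad f y q a.
Proof.
move=> cf nfx; have [[_ [z0 fz0]] _ lf] := cf.
have [z [c [fzc cx]]] : exists z c, (f z <= c%:E)%E /\ ((c - dot p (z - x))%:E < f x)%E.
  have [fxoo|fxoo] := eqVneq (f x) +oo%E.
    exists z0, (fine (f z0)); rewrite fxoo ltry; split=> //.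
    by rewrite fineK// fin_real// fz0 andbT; case: cf => -[].
  have [a fxa _] : exists2 a, f x = a%:E & a <= fine (f x).
    apply: closed_convex_fin => //; rewrite fineK// fin_real//.
    by rewrite ltey fxoo andbT; case: cf => -[].
  apply: contrapT => nz; apply: (nfx a); split=> // y b fyb; rewrite leNgt; apply/negP => ba.
  by apply: nz; exists y, b; split=> //; rewrite fxa lte_fin; lra.
have [b /andP[]] := ereal_lt_real cx; rewrite lte_fin => cb /lf[V /nbhs_enormP[e e0 xV] Vb].
pose D := enorm p + enorm (z - x) + 2.
have D0 : 0 < D by rewrite /D; have := enorm_ge0 p; have := enorm_ge0 (z - x); lra.
have [t [t0 te t1 tD]] : exists t : R, [/\ 0 < t, t <= e, t <= 1 & t * D <= b - (c - dot p (z - x))].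
  exists (Num.min e (Num.min 1 ((b - (c - dot p (z - x))) / D))).
  rewrite !lt_min e0 ltr01 divr_gt0 ?subr_gt0// !ge_min !lexx !orbT; split=> //.
  by rewrite -ler_pdivlMr// !ge_min lexx !orbT.
exists t => // y q a yx qp fy.
have /Vb : V y by apply: xV; exact: lt_le_trans te.
have [fya fq] := fy; rewrite fya lte_fin => ba; have := fq z c fzc.
have yz : enorm (z - y) <= enorm (z - x) + t.
  by have := enorm_dist z x y; rewrite (enormB x y); lra.
have := cauchy_schwarzN (q - p) (z - y); have := cauchy_schwarzN p (x - y).
have := ler_pM (enorm_ge0 _) (enorm_ge0 _) (ltW qp) yz.
have := ler_wpM2l (enorm_ge0 p) (ltW yx); rewrite (enormB x y).
have -> : dot q (z - y) = dot (q - p) (z - y) + dot p (z - x) + dot p (x - y).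
  by rewrite dotBl !dotBr; ring.
have : t * t <= t * 1 by rewrite ler_pM2l.
by rewrite /D in tD; lra.
Qed.

(** If no p in the compact ball of radius a + e is a subgradient at x, the
    same holds at all points near x, so the slope there is at least a + e. *)
Lemma slope_epi_closed f : closed_convex f -> epi_closed (slope f).
Proof.
move=> cf [x a] sxa; rewrite /epi /=; apply/lee_addgt0Pr => e e0; rewrite -EFinD.
have [[p [c [fx pa]]]|no_p] := pselect (exists p c, subgrad f x p c /\ enorm p <= a + e).
  by apply: le_trans (slope_le cf fx) _; rewrite lee_fin.
have /compact_near_coveringP cover := @enorm_ball_compact R d 0 (a + e).
have : \forall y \near x, [set q | enorm (q - 0) <= a + e] `<=`
    [set q | forall c, ~ subgrad f y q c].
  apply: (cover _ (nbhs x) (fun y q => forall c, ~ subgrad f y q c)) => q /=.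
  rewrite subr0 => qa.
  have [c fq|t t0 nfq] := @not_subgrad_near f x q cf.
    by apply: no_p; exists q, c.
  have tx : \forall y \near x, enorm (y - x) < t by apply/nbhs_enormP; exists t.
  have tq : \forall q' \near q, enorm (q' - q) < t by apply/nbhs_enormP; exists t.
  near=> q' y.
  have yx : enorm (y - x) < t by near: y.
  have qq : enorm (q' - q) < t by near: q'.
  by move=> c; exact: nfq.
move=> /nbhs_enormP[t t0 no_q].
have e'0 : 0 < Num.min (t / 2) (e / 2) by rewrite lt_min !divr_gt0.
have [[y b] syb /= [yx ba]] := sxa _ e'0.
have yt : enorm (y - x) < t by move: yx; rewrite /= le_min => /andP[yx _]; lra.
have [|q [c [fy qb]]] := @slope_lt f y (a + e) cf.
  apply: le_lt_trans syb _; rewrite lte_fin /=.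
  by move: ba; rewrite /= le_min => /andP[_]; rewrite ler_norml => /andP[_ ba]; lra.
by have := no_q y yt q; rewrite /= subr0 => /(_ (ltW qb) c).
Unshelve. all: by end_near. Qed.

End Slope.

(** * Epigraphical limits and normalizing sequences *)

Section EpigraphicalLimits.
Context {R : realType} {d : nat}.
Implicit Types (f g h : 'rV[R]_d -> \bar R) (G H : nat -> 'rV[R]_d -> \bar R).
Implicit Types (x y p q w : 'rV[R]_d) (a b c m : R).

Lemma exists_subgrad f : closed_convex f -> exists x p a, subgrad f x p a.
Proof.
move=> cf; have [[fNy [x fx]] _ lf] := cf.
have fxE : f x = (fine (f x))%:E by rewrite fineK// fin_real// fNy fx.
have [||w w1 wmin] := @lsc_attains_min R _ f [set y | enorm (y - x) <= 1] _ _ lf.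
- exact: enorm_ball_compact.
- by exists x; rewrite /= subrr enorm0.
have wx : (f w <= (fine (f x))%:E)%E by rewrite -fxE; apply: wmin; rewrite /= subrr enorm0.
have [b fw bx] := closed_convex_fin cf wx.
have c0 : 0 < fine (f x) - b + 1 by lra.
have fxx : (f x <= (fine (f x))%:E)%E by rewrite -fxE.
have [||y [p [a [fy _ _ _]]]] := approx_by_graph (m := b) cf ltr01 c0 fxx.
- by lra.
- by move=> y v y1 fyv; rewrite -lee_fin -fw; exact: le_trans (wmin y y1) fyv.
by exists y, p, a.
Qed.

(** If the bound failed near some x for infinitely many n, the offending points
    would form a sequence converging to x along which the lower limit is at
    most m - e. *)
Lemma eventually_above_of_epi_liminf G m :
  (forall x, m%:E <= epi_liminf G x)%E -> eventually_above G m.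
Proof.
move=> mG r e e0.
have /compact_near_coveringP cover := @enorm_ball_compact R d 0 r.
suff : \forall n \near \oo, [set x | enorm (x - 0) <= r] `<=`
    [set x | forall b, (G n x <= b%:E)%E -> m - e <= b].
  by apply: filterS => n sub x b xr; apply: sub; rewrite /= subr0.
apply: (cover nat \oo (fun n x => forall b, (G n x <= b%:E)%E -> m - e <= b)) => x _.
have [[e1 [e10 [N aboveN]]]|none] := pselect (exists e1 : R, 0 < e1 /\
    exists N, forall n, (N <= n)%N -> forall y b, enorm (y - x) < e1 ->
      (G n y <= b%:E)%E -> m - e <= b).
  have xe : \forall y \near x, enorm (y - x) < e1 by apply/nbhs_enormP; exists e1.
  near=> y n.
  have Nn : (N <= n)%N by near: n; exists N.
  have yx : enorm (y - x) < e1 by near: y.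
  by move=> b; exact: (aboveN n Nn y b yx).
exfalso.
have bad k : exists ny : nat * 'rV[R]_d, [/\ (k <= ny.1)%N,
    enorm (ny.2 - x) < k.+1%:R^-1 & (G ny.1 ny.2 <= (m - e)%:E)%E].
  apply: contrapT => nbad; apply: none; exists k.+1%:R^-1.
  split; first by rewrite invr_gt0.
  exists k => n kn y b yx gyb; rewrite leNgt; apply/negP => bm.
  by apply: nbad; exists (n, y); split=> //=; rewrite (le_trans gyb)// lee_fin ltW.
have [s sP] := choice bad.
(* The bad points, put at their own indices and completed by x, form a
   sequence converging to x. *)
pose u n := if pselect (exists k, (s k).1 = n) is left h then (s (projT1 (cid h))).2 else x.
have ux : u @ \oo --> x.
  apply/cvg_enormP => t t0.
  have [k0 _ k0t] := near_infty_natSinv_lt (PosNum t0).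
  near=> n; rewrite /u; case: pselect => [h|_]; last by rewrite subrr enorm0.
  case: (cid h) => k /= kn; have [_ skx _] := sP k.
  apply: (lt_trans skx); apply: k0t; rewrite /= leqNgt; apply/negP => kk0.
  have : (n <= \max_(i < k0) (s i).1)%N by rewrite -kn (leq_bigmax (Ordinal kk0)).
  by rewrite leqNgt => /negP; apply; near: n; exact: nbhs_infty_gt.
have : (limn_einf (fun n => G n (u n)) <= (m - e)%:E)%E.
  apply: limn_einf_le => N; have [Ns _ _] := sP N; exists (s N).1 => //.
  rewrite /u; case: pselect => [h|[]]; last by exists N.
  by case: (cid h) => k /= <-; have [_ _] := sP k.
apply/negP; rewrite -ltNge; apply: lt_le_trans (le_trans (mG x) _).
  by rewrite lte_fin; lra.
by apply: ereal_inf_lbound; exists u.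
Unshelve. all: by end_near. Qed.

Lemma epi_liminf_ge G m : eventually_above G m ->
  forall x, (m%:E <= epi_liminf G x)%E.
Proof.
move=> Gm x; apply: le_ereal_inf_tmp => _ [u /= /cvg_enormP ux <-].
apply/lee_addgt0Pr => e e0; rewrite -leeBlDr// -EFinB; apply: limn_einf_ge.
apply: filterS2 (ux 1 ltr01) (Gm (enorm x + 1) e e0) => n uxn above.
have ur : enorm (u n) <= enorm x + 1 by have := enorm_le_dist (u n) x; lra.
rewrite leNgt; apply/negP => /ereal_lt_real[b /andP[gb bm]].
by move: bm; apply/negP; rewrite -leNgt lee_fin; apply: above ur (ltW gb).
Qed.

Lemma eventually_reaches_of_epi_limsup G m :
  (ereal_inf (range (epi_limsup G)) <= m%:E)%E -> eventually_reaches G m.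
Proof.
move=> Gm e e0.
have /ereal_inf_lt[_ [x _ <-] /ereal_inf_lt[_ [u /= /cvg_enormP ux <-] ue]] :
    (ereal_inf (range (epi_limsup G)) < (m + e)%:E)%E.
  by rewrite (le_lt_trans Gm)// lte_fin; lra.
exists (enorm x + 1); apply: filterS2 (ux 1 ltr01) (limn_esup_lt ue) => n uxn gu.
exists (u n), (m + e); split=> //; last exact: ltW.
by have := enorm_le_dist (u n) x; lra.
Qed.

Lemma epi_limsup_le G y b : (forall n, exists z, (G n z < +oo)%E) ->
  (forall n x, -oo < G n x)%E ->
  (forall e : R, 0 < e -> \forall n \near \oo, near_set (epi (G n)) (y, b) e) ->
  (epi_limsup G y <= b%:E)%E.
Proof.
move=> Gfin GNy near_y.
have [|||u Gu small] := @near_optimal_selection R ('rV[R]_d * R)%type (fun n => epi (G n))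
    (fun n z => enorm (z.1 - y) + `|z.2 - b|).
- by move=> n t; rewrite addr_ge0 ?enorm_ge0.
- move=> n; have [z gz] := Gfin n; exists (z, fine (G n z)).
  by rewrite /epi /= fineK// fin_real// GNy gz.
- move=> e e0; have e2 : 0 < e / 2 by lra.
  apply: filterS (near_y _ e2) => n [w Gw [w1 w2]]; exists w => //.
  by move: w1 w2 => /=; lra.
apply: (@le_trans _ _ (limn_esup (fun n => G n (u n).1))).
  apply: ereal_inf_lbound; exists (fun n => (u n).1) => //=.
  apply/cvg_enormP => e e0; have e2 : 0 < e / 2 by lra.
  by apply: filterS (small _ e2) => n; have := normr_ge0 ((u n).2 - b); lra.
apply/lee_addgt0Pr => e e0; rewrite -EFinD; apply: limn_esup_le.
apply: filterS (small _ e0) => n le_e; apply: le_trans (Gu n) _; rewrite lee_fin.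
by have := ler_norm ((u n).2 - b); have := enorm_ge0 ((u n).1 - y); lra.
Qed.

Lemma normalized_at_of_cvg f G x p a (x_ p_ : nat -> 'rV[R]_d) :
  (forall n, closed_convex (G n)) -> f x = a%:E ->
  (forall n, subdiff (G n) (x_ n) (p_ n)) ->
  (x_ n, p_ n, G n (x_ n)) @[n --> \oo] --> (x, p, f x) ->
  normalized_at G x p a.
Proof.
move=> cG fx Gp cvg_xp e e0; rewrite fx in cvg_xp.
pose V : set ('rV[R]_d * 'rV[R]_d * \bar R) := [set t | (enorm (t.1.1 - x) <= e /\
  enorm (t.1.2 - p) <= e) /\ exists2 b, t.2 = b%:E & `|b - a| <= e].
have : nbhs (x, p, a%:E) V.
  exists ([set t | enorm (t.1 - x) <= e /\ enorm (t.2 - p) <= e],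
          [set v | exists2 b, v = b%:E & `|b - a| <= e]); last by move=> [[? ?] ?].
  split=> /=.
    exists ([set y | enorm (y - x) <= e], [set q | enorm (q - p) <= e]); last by case.
    by split; apply/nbhs_enormP; exists e => // y /ltW.
  have : \forall b \near a, `|b - a| <= e.
    by apply/nbhs_ballP; exists e => // b; rewrite -ball_normE /ball_ /= distrC => /ltW.
  by apply: filterS => b ba; exists b.
move=> /cvg_xp xpV.
apply: (@filterS _ \oo _ (fun n => V (x_ n, p_ n, G n (x_ n)))) xpV => n [[/= xn pn] [b gb ba]].
have [c gx] := iffLR (closed_convex_subdiffP _ _ (cG n)) (Gp n).
exists (x_ n), (p_ n), b; split=> //.
by have [gc _] := gx; move: gx; rewrite gc in gb; case: gb => ->.
Qed.

Lemma cvg_of_normalized_at f G x p a :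
  (forall n, closed_convex (G n)) -> f x = a%:E -> normalized_at G x p a ->
  exists x_ p_ : nat -> 'rV[R]_d, (forall n, subdiff (G n) (x_ n) (p_ n)) /\
    (x_ n, p_ n, G n (x_ n)) @[n --> \oo] --> (x, p, f x).
Proof.
move=> cG fx Gx.
have [|||u Gu small] := @near_optimal_selection R ('rV[R]_d * 'rV[R]_d * R)%type
    (fun n t => subgrad (G n) t.1.1 t.1.2 t.2)
    (fun n t => enorm (t.1.1 - x) + enorm (t.1.2 - p) + `|t.2 - a|).
- by move=> n t; rewrite !addr_ge0 ?enorm_ge0.
- move=> n; have [y [q [b gy]]] := exists_subgrad (cG n).
  by exists (y, q, b).
- move=> e e0; have e3 : 0 < e / 3 by lra.
  apply: filterS (Gx _ e3) => n [y [q [b [gy yx qp ba]]]].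
  by exists (y, q, b) => //=; lra.
exists (fun n => (u n).1.1), (fun n => (u n).1.2); split=> [n|].
  by apply/closed_convex_subdiffP => //; exists (u n).2; exact: Gu.
have GuE n : G n (u n).1.1 = (u n).2%:E by case: (Gu n).
rewrite fx; under eq_fun do rewrite GuE.
have cx : (u n).1.1 @[n --> \oo] --> x.
  apply/cvg_enormP => e e0; have e2 : 0 < e / 2 by lra.
  apply: filterS (small _ e2) => n.
  by have := enorm_ge0 ((u n).1.2 - p); have := normr_ge0 ((u n).2 - a); lra.
have cp : (u n).1.2 @[n --> \oo] --> p.
  apply/cvg_enormP => e e0; have e2 : 0 < e / 2 by lra.
  apply: filterS (small _ e2) => n.
  by have := enorm_ge0 ((u n).1.1 - x); have := normr_ge0 ((u n).2 - a); lra.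
have ca : (u n).2%:E @[n --> \oo] --> a%:E.
  apply: cvg_EFin; first exact: nearW.
  apply/cvgrPdist_le => e e0; apply: filterS (small _ e0) => n.
  by rewrite /= distrC; have := enorm_ge0 ((u n).1.1 - x); have := enorm_ge0 ((u n).1.2 - p); lra.
exact: (cvg_pair (cvg_pair cx cp) ca).
Qed.

End EpigraphicalLimits.

(** * The slope version of the Attouch theorem *)

Unset Implicit Arguments.
Set Strict Implicit.

Theorem theorem1p6 (R : realType) (d : nat)
    (f : 'rV[R]_d -> \bar R) (f_ : nat -> 'rV[R]_d -> \bar R)
    (f_proper : proper_fun f) (f_convex : convex_fun f)
    (f_lsc : lower_semicontinuous f)
    (fn_proper : forall n, proper_fun (f_ n))
    (fn_convex : forall n, convex_fun (f_ n))
    (fn_lsc : forall n, lower_semicontinuous (f_ n))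
    (inf_f_real : ereal_inf (range f) \is a fin_num) :
  [<-> epi_cvg f_ f;
       epi_cvg (fun n => slope (f_ n)) (slope f) /\
       exists (x p : 'rV[R]_d), subdiff f x p /\
         exists (x_ p_ : nat -> 'rV[R]_d),
           (forall n, subdiff (f_ n) (x_ n) (p_ n)) /\
           (x_ n, p_ n, f_ n (x_ n)) @[n --> \oo] --> (x, p, f x);
       epi_cvg (fun n => slope (f_ n)) (slope f) /\
       ereal_inf (range (epi_liminf f_)) = ereal_inf (range f) /\
       ereal_inf (range f) = ereal_inf (range (epi_limsup f_))].
Proof.
have cf : closed_convex f by split.
have cfn n : closed_convex (f_ n) by split.
pose m := fine (ereal_inf (range f)).
have infE : ereal_inf (range f) = m%:E by rewrite fineK.
have f_above y b : (f y <= b%:E)%E -> m <= b.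
  by rewrite -lee_fin -infE; apply: le_trans; apply: ereal_inf_lbound; exists y.
have f_reach e : 0 < e -> exists y b, (f y <= b%:E)%E /\ b <= m + e.
  move=> e0; have /ereal_inf_lt[_ [y _ <-] fy] : (ereal_inf (range f) < (m + e)%:E)%E.
    by rewrite infE lte_fin; lra.
  by exists y, (m + e); rewrite (ltW fy).
have cst_above : eventually_above (fun=> f) m.
  by move=> r e e0; apply: nearW => n x b _ /f_above; lra.
have cst_reach : eventually_reaches (fun=> f) m.
  move=> e e0; have [y [b [fyb bm]]] := f_reach e e0.
  by exists (enorm y); apply: nearW => n; exists y, b.
have [x0 [p0 [a0 fx0]]] := exists_subgrad cf.
have slopes_graph : epi_cvg (fun n => slope (f_ n)) (slope f) ->
    graph_excess_to0 (fun=> f) f_ /\ graph_excess_to0 f_ (fun=> f).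
  by move=> /epi_excess_of_cvg[? ?]; split; exact: graph_excess_of_slope_excess.
have epi_of_bounds : epi_cvg (fun n => slope (f_ n)) (slope f) ->
    eventually_above f_ m -> eventually_reaches f_ m ->
    epi_excess_to0 (fun=> f) f_ /\ epi_excess_to0 f_ (fun=> f).
  by move=> /slopes_graph[? ?] ? ?; split; apply: (epi_excess_of_graph_excess (m := m)).
tfae.
- move=> /epi_excess_of_cvg[ff_ f_f].
  have fn_above := eventually_above_excess f_f cst_above.
  have fn_reach := eventually_reaches_excess ff_ cst_above cst_reach.
  split.
    apply: epi_cvg_of_excess; first exact: slope_epi_closed.
      by apply: slope_excess_of_graph_excess => //; exact: (graph_excess_of_epi_excess (m := m)).
    by apply: slope_excess_of_graph_excess => //; exact: (graph_excess_of_epi_excess (m := m)).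
  exists x0, p0; split; first by apply/closed_convex_subdiffP => //; exists a0.
  apply: cvg_of_normalized_at => //; first by case: fx0 => fx0 _; exact: fx0.
  move=> e e0; pose r := enorm x0 + enorm p0 + `|a0|.
  have := subgrad_transfer_near r e0 cfn ff_ f_f; apply: filterS => n transfer.
  have := enorm_ge0 x0; have := enorm_ge0 p0; have := normr_ge0 a0 => h1 h2 h3.
  by apply: transfer fx0; rewrite /r; lra.
- move=> [slopes [x [p [fxp [x_ [p_ [fnp cvg_xp]]]]]]]; split=> //.
  have [a fx] := iffLR (closed_convex_subdiffP _ _ cf) fxp.
  have normalized := normalized_at_of_cvg cfn (proj1 fx) fnp cvg_xp.
  have [gff_ gf_f] := slopes_graph slopes.
  have fn_above := eventually_above_of_normalized cf f_above fx normalized gff_.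
  have ma := f_above _ _ (subgrad_finite fx).
  have fn_reach := eventually_reaches_of_normalized cfn f_reach ma fx normalized gf_f fn_above.
  have [ff_ f_f] := epi_of_bounds slopes fn_above fn_reach.
  have lower : (m%:E <= ereal_inf (range (epi_liminf f_)))%E.
    by apply: le_ereal_inf_tmp => _ [y _ <-]; exact: epi_liminf_ge.
  have lu : (ereal_inf (range (epi_liminf f_)) <= ereal_inf (range (epi_limsup f_)))%E.
    apply: le_ereal_inf_tmp => _ [y _ <-].
    apply: (@le_trans _ _ (epi_liminf f_ y)); first by apply: ereal_inf_lbound; exists y.
    apply: le_ereal_inf_tmp => _ [u uy <-]; apply: le_trans (limn_einf_sup _).
    by apply: ereal_inf_lbound; exists u.
  have upper : (ereal_inf (range (epi_limsup f_)) <= m%:E)%E.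
    apply/lee_addgt0Pr => e e0; rewrite -EFinD.
    have [y [b [fyb bm]]] := f_reach e e0.
    apply: (@le_trans _ _ (epi_limsup f_ y)); first by apply: ereal_inf_lbound; exists y.
    apply: (@le_trans _ _ b%:E); last by rewrite lee_fin.
    apply: epi_limsup_le => [n|n|t t0]; [by case: (fn_proper n)|by case: (fn_proper n)|].
    apply: filterS (ff_ (enorm y + `|b|) t t0) => n sub.
    have [||z [c [fz zy cb]]] := sub y b _ _ fyb.
    + by rewrite lerDl.
    + by rewrite lerDr enorm_ge0.
    by exists (z, c).
  rewrite infE; split; apply/eqP; rewrite eq_le.
    by rewrite lower (le_trans lu).
  by rewrite upper (le_trans lower).
- move=> [slopes [inf_l inf_u]].
  have fn_above : eventually_above f_ m.
    apply: eventually_above_of_epi_liminf => x; rewrite -infE -inf_l.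
    by apply: ereal_inf_lbound; exists x.
  have fn_reach : eventually_reaches f_ m.
    by apply: eventually_reaches_of_epi_limsup; rewrite -inf_u infE.
  have [ff_ f_f] := epi_of_bounds slopes fn_above fn_reach.
  by apply: epi_cvg_of_excess => //; exact: closed_convex_epi_closed.
Qed.
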